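(* Let $G$ be a countable group and let $S$ be a finite non-empty amenably-visible subset of $G$. Then for a generic probability measure $\nu$ on $G$, the stabilizer of almost every point of the Poisson boundary $\partial(G,\nu)$ has non-empty intersection with $S$. The same holds for a generic symmetric probability measure $\nu$ on $G$.
   Context: A finite subset $S$ of a group $G$ is amenably-visible if there is an amenable subgroup $H$ of $G$ such that $S\cap H^\gamma\neq\varnothing$ for all $\gamma\in G$, where $H^\gamma=\gamma^{-1}H\gamma$ (equivalently, $S^\gamma\cap H\ne\varnothing$ for all $\gamma\in G$). $\mathcal{M}(G)$ is the space of all probability measures on $G$ with the total variation ($\ell^1$) distance. A measure is symmetric if $\nu(g)=\nu(g^{-1})$ for all $g$; the symmetric probability measures form a subspace with the same distance. A property holds for a generic (resp. generic symmetric) probability measure if the set of measures having it is residual (contains a countable intersection of dense open sets) in $\mathcal{M}(G)$ (resp. in the subspace of symmetric probability measures). Properties of the action on the Poisson boundary are understood to include non-degeneracy of $\nu$: $\nu$ is non-degenerate if its support generates $G$ as a semigroup. Poisson boundary: let $(X_i)_{i\ge 1}$ be i.i.d. with distribution $\nu$, $Z_i=X_1\cdots X_i$, and let $\eta$ be the distribution of $(Z_i)_{i\geq 1}$ on $\Omega=\prod_{i\ge1}G$. The Poisson boundary $\partial(G,\nu)$ is the space of ergodic components of the time shift on $(\Omega,\eta)$, i.e. the standard probability space together with a measurable map $\Omega\to\partial(G,\nu)$ such that the preimage of its $\sigma$-algebra is, modulo $\eta$-null sets, the $\sigma$-algebra of shift-invariant measurable sets (for non-degenerate $\nu$ this coincides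 with the tail $\sigma$-algebra mod $\eta$). The coordinatewise action $\gamma\cdot(g_1,g_2,\ldots)=(\gamma g_1,\gamma g_2,\ldots)$ induces, for non-degenerate $\nu$, a quasi-invariant (measure-class preserving) action of $G$ on $\partial(G,\nu)$. *)

(* Defs.v *)
From HB Require Import structures.
From mathcomp Require Import all_boot all_order all_algebra finmap.
From mathcomp Require Import all_classical all_reals all_analysis.

Set Implicit Arguments.
Unset Strict Implicit.
Unset Printing Implicit Defensive.

Import Order.TTheory GRing.Theory Num.Theory.
Import numFieldNormedType.Exports.

Local Open Scope classical_set_scope.
Local Open Scope ring_scope.

Section Residual.
Context {T : topologicalType}.

Definition residual (A : set T) : Prop :=
  exists U : (set T)^nat,
    (forall n, open (U n) /\ dense (U n)) /\ \bigcap_n U n `<=` A.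

End Residual.

Section Amenability.
Context (R : realType) (G : groupType).

(* von Neumann's definition, for a subgroup H of the discrete group G: a
   left-invariant finitely additive probability measure on all subsets of H. *)
Definition amenable (H : set G) : Prop :=
  exists m : set G -> R,
    [/\ m H = 1,
        forall A, A `<=` H -> 0 <= m A,
        forall A B, A `<=` H -> B `<=` H -> A `&` B = set0 ->
          m (A `|` B) = m A + m B
      & forall h A, H h -> A `<=` H -> m [set (h * a)%g | a in A] = m A].

(* (h ^ g)%g is g^-1 * h * g. *)
Definition amenably_visible (S : set G) : Prop :=
  exists H : set G,
    [/\ group_closed [in H], amenable H
      & forall g : G, S `&` [set (h ^ g)%g | h in H] !=set0].

End Amenability.

Definition discr (G : groupType) : Type := G.

HB.instance Definition _ (G : groupType) := Group.on (discr G).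
HB.instance Definition _ (G : groupType) := isPointed.Build (discr G) 1%g.
HB.instance Definition _ (G : groupType) :=
  @isMeasurable.Build default_measure_display (discr G) discrete_measurable
    discrete_measurable0 discrete_measurableC discrete_measurableU.

Section ProbabilityMeasures.
Context (R : realType) (G : groupType).

Definition prob_measures : Type := probability (discr G) R.

HB.instance Definition _ := Choice.on prob_measures.

Definition l1dist (mu nu : prob_measures) : \bar R :=
  (\esum_(g in [set: discr G]) `|mu [set g] - nu [set g]|)%E.

Let l1ball (mu : prob_measures) (e : R) : set prob_measures :=
  [set nu | (l1dist mu nu < e%:E)%E].

Let l1ent : set_system (prob_measures * prob_measures) := entourage_ l1ball.

Let l1nbhs (mu : prob_measures) : set_system prob_measures := nbhs_ l1ent mu.

HB.instance Definition _ := hasNbhs.Build prob_measures l1nbhs.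

Let l1nbhsE : l1nbhs = nbhs_ l1ent. Proof. by []. Qed.

Let l1entE : l1ent = entourage_ l1ball. Proof. by []. Qed.

Let l1ball_center mu (e : R) : 0 < e -> l1ball mu e mu.
Proof.
move=> e0; rewrite /l1ball /= /l1dist esum1 ?lte_fin// => g _.
by rewrite subee ?abse0// fin_num_measure.
Qed.

Let l1ball_sym mu nu (e : R) : l1ball mu e nu -> l1ball nu e mu.
Proof.
rewrite /l1ball /=; congr (_ < _)%E; apply: eq_esum => g _.
rewrite -abseN fin_num_oppeB ?fin_num_measure// addeC//.
Qed.

Let l1ball_triangle la mu nu (e1 e2 : R) :
  l1ball la e1 mu -> l1ball mu e2 nu -> l1ball la (e1 + e2) nu.
Proof.
rewrite /l1ball /= => h1 h2; rewrite EFinD.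
apply: le_lt_trans (lteD h1 h2).
rewrite /l1dist -esumD; [|by move=> *; exact: abse_ge0..].
apply: le_esum => g _.
have fin (x : prob_measures) : x [set g] \is a fin_num.
  exact: fin_num_measure.
rewrite -(fineK (fin la)) -(fineK (fin mu)) -(fineK (fin nu)).
rewrite -!EFinB !abse_EFin -EFinD lee_fin.
exact: ler_distD.
Qed.

HB.instance Definition _ := @Nbhs_isPseudoMetric.Build R prob_measures
  l1ent l1nbhsE l1ball l1ball_center l1ball_sym l1ball_triangle l1entE.

Definition symmetric_measures : set prob_measures :=
  [set nu : prob_measures | forall g : discr G, nu [set g] = nu [set (g^-1)%g]].

Definition support (nu : prob_measures) : set (discr G) :=
  [set g | nu [set g] != 0%E].

Definition nondegenerate (nu : prob_measures) : Prop :=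
  smallest (fun H : set (discr G) => forall x y, H x -> H y -> H (x * y)%g)
    (support nu) = [set: discr G].

End ProbabilityMeasures.

Section PathSpace.
Context (G : groupType).

Definition cylinders : set (set (nat -> discr G)) :=
  [set A | exists n (B : set (discr G)), A = [set w | B (w n)]].

(* One-sided sequences with the product sigma-algebra; the coordinate n is the
   position at time n.+1, so the (deterministic) position at time 0 is not
   recorded. *)
Definition paths := g_sigma_algebraType cylinders.

HB.instance Definition _ := Measurable.on paths.

Definition shift (w : paths) : paths := fun n => w n.+1.

Definition translate (g : G) (w : paths) : paths := fun n => (g * w n : G)%g.

Definition shift_invariant (A : set paths) : Prop :=
  measurable A /\ shift @^-1` A = A.

End PathSpace.

Section RandomWalk.
Context (R : realType) (G : groupType).

Definition mutually_independent d d' (T : measurableType d)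
    (T' : measurableType d') (P : probability T R)
    (X : nat -> {RV P >-> T'}) : Prop :=
  forall (J : {fset nat}) (A : nat -> set T'),
    (forall i, measurable (A i)) ->
    P (\bigcap_(i in [set` J]) (X i @^-1` A i))
      = (\prod_(i <- J) P (X i @^-1` A i))%E.

Definition iid d (T : measurableType d) (P : probability T R)
    (nu : prob_measures R G) (X : nat -> {RV P >-> discr G}) : Prop :=
  mutually_independent X /\
  forall i (A : set (discr G)), distribution P (X i) A = nu A.

(* X i is the (i+1)-st increment, the coordinate n of the walk is
   X 0 * ... * X n. *)
Definition walk d (T : measurableType d) (P : probability T R)
    (X : nat -> {RV P >-> discr G}) (t : T) : paths G :=
  fun n => (\prod_(i < n.+1) (X i t : G))%g.

Definition walk_law (nu : prob_measures R G) (eta : probability (paths G) R)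
    : Prop :=
  exists (d : measure_display) (T : measurableType d) (P : probability T R)
      (X : nat -> {RV P >-> discr G}),
    iid nu X /\
    forall A : set (paths G), measurable A -> eta A = P (walk X @^-1` A).

End RandomWalk.

Section Boundary.
Context (R : realType) (G : groupType).

(* B is Borel-isomorphic to a Polish space. *)
Definition standard_borel d (B : measurableType d) : Prop :=
  exists (M : completePseudoMetricType R) (f : B -> M),
    [/\ hausdorff_space M, second_countable (T := M), bijective f
      & (measurable : set (set B))
          = preimage_set_system [set: B] f <<s @open M >>].

(* (B, bnd_* eta) is the space of ergodic components of the shift: bnd
   generates the shift-invariant sigma-algebra modulo eta-null sets. *)
Definition poisson_boundary (eta : probability (paths G) R) d
    (B : measurableType d) (bnd : {mfun paths G >-> B}) : Prop :=
  [/\ standard_borel B,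
      forall C : set B, measurable C ->
        exists2 A, shift_invariant A & eta (bnd @^-1` C `+` A) = 0%E
    & forall A, shift_invariant A ->
        exists2 C : set B, measurable C & eta (bnd @^-1` C `+` A) = 0%E].

(* a measurable action of G on B induced by the coordinatewise one *)
Definition induced_action (eta : probability (paths G) R) d
    (B : measurableType d) (bnd : {mfun paths G >-> B})
    (act : G -> B -> B) : Prop :=
  [/\ forall x, act 1%g x = x,
      forall g h x, act (g * h)%g x = act g (act h x),
      forall g, measurable_fun [set: B] (act g)
    & forall g, {ae eta, forall w, bnd (translate g w) = act g (bnd w)}].

Definition stabilizer (B : Type) (act : G -> B -> B) (x : B) : set G :=
  [set g | act g x = x].

(* The law eta exists and is unique, and for non-degenerate nu the boundary and
   the action exist and are unique up to isomorphism modulo null sets; hence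
   the quantification over all their realizations. *)
Definition boundary_stabilizers_meet (S : set G) (nu : prob_measures R G)
    : Prop :=
  nondegenerate nu /\
  forall (eta : probability (paths G) R) (d : measure_display)
      (B : measurableType d) (bnd : {mfun paths G >-> B}) (act : G -> B -> B),
    walk_law nu eta -> poisson_boundary eta bnd -> induced_action eta bnd act ->
    {ae distribution eta bnd, forall x, stabilizer act x `&` S !=set0}.

End Boundary.

(* Main.v *)
(** Let [H] be an amenable subgroup all of whose conjugates meet [S].
If the points of a non-null part of the boundary are fixed by no element of
[S], there is a shift-invariant event [A] of positive probability such that [A]
and [s^-1 A] are almost disjoint for all [s] in [S].  As [A] is approximated by
events depending on finitely many steps, the harmonic function [u x = P_x(A)]
takes at some [x] a value close to [1], and then [u (s x)] is close to [0] for
all [s] in [S].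

For a generic measure this separation is impossible.  Near any measure there is
one of the form [sigma + (1 - |sigma|) lambda], with [sigma] finitely supported
of mass less than [1] and fixed before [lambda].  Iterating harmonicity until
the first [lambda]-step, [u x] and the [u (s x)] are, up to a small error,
averages of [lambda]-averages of [u] at [y] and at [s y], where [y] ranges over
a finite set known before [lambda] is chosen.  For each such [y] some [s ^ y]
lies in [H], and if [lambda = rho * rho^check] with [rho] on [H] almost
invariant under these finitely many conjugates, then the averages at [y] and
[s y = y (s ^ y)] almost agree.  This tolerates small perturbations of the
measure, so it holds on an open dense set for each [x]. *)

From HB Require Import structures.
Require Import Defs.
From mathcomp Require Import all_boot all_order all_algebra finmap.
From mathcomp Require Import all_classical all_reals all_analysis.
From mathcomp Require Import ring lra.

Set Implicit Arguments.
Unset Strict Implicit.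
Unset Printing Implicit Defensive.

Import Order.TTheory GRing.Theory Num.Theory.
Import numFieldNormedType.Exports.

Local Open Scope classical_set_scope.
Local Open Scope ring_scope.

(** * Hahn-Banach *)

Section HahnBanach.
Context (R : realType) (V : lmodType R).
Implicit Types (p q : V -> R) (x y z : V).

(** Scaling is only an inequality for [a > 0], which is easy to check on infima; applying it to
    [a^-1] gives equality. *)
Definition sublinear p : Prop :=
  (forall x y, p (x + y) <= p x + p y) /\
  (forall a x, 0 < a -> p (a *: x) <= a * p x).

Lemma sublinear0 p : sublinear p -> p 0 = 0.
Proof.
move=> [_ h].
have h2 := h 2 0 (ltr0n _ 2); have h3 := h 2^-1 0 ltac:(by rewrite invr_gt0).
by move: h2 h3; rewrite !scaler0; lra.
Qed.

Lemma sublinear_oppr_ge p x : sublinear p -> - p (- x) <= p x.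
Proof.
by move=> hp; have := hp.1 x (- x); rewrite subrr (sublinear0 hp); lra.
Qed.

Lemma sublinear_homog p a x : sublinear p -> 0 <= a -> p (a *: x) = a * p x.
Proof.
move=> hp; rewrite le_eqVlt => /predU1P[<-|a0].
  by rewrite scale0r mul0r sublinear0.
apply/eqP; rewrite eq_le hp.2//=.
have ai0 : 0 < a^-1 by rewrite invr_gt0.
have := hp.2 a^-1 (a *: x) ai0.
by rewrite scalerA mulVf ?gt_eqF// scale1r -(ler_pM2l a0) mulVKf ?gt_eqF.
Qed.

(** The bound [- p (- x)] keeps the pointwise infimum finite. Subadditivity passes to it because, of
    two members of a chain, the smaller can serve in both terms. *)
Lemma sublinear_chain_inf p (A : set (V -> R)) :
  A !=set0 -> (forall q, A q -> sublinear q /\ forall x, q x <= p x) ->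
  total_on A (fun q r => forall x, r x <= q x) ->
  exists q, (sublinear q /\ forall x, q x <= p x) /\
            forall r, A r -> forall x, q x <= r x.
Proof.
move=> [q0 Aq0] AS Atot.
pose E x := [set q x | q in A].
have E0 x : E x !=set0 by exists (q0 x), q0.
have Elb x : has_lbound (E x).
  exists (- p (- x)) => _ [q Aq <-].
  have [sq qp] := AS _ Aq.
  by rewrite (le_trans _ (sublinear_oppr_ge _ sq))// lerN2.
have Einf r x : A r -> inf (E x) <= r x by move=> Ar; apply: ge_inf => //; exists r.
exists (fun x => inf (E x)); split; last by move=> r Ar x; exact: Einf.
split; last by move=> x; rewrite (le_trans (Einf _ x Aq0))// (AS _ Aq0).2.
split=> [x y|a x a0].
- rewrite -lerBlDr; apply: lb_le_inf => // _ [q Aq <-].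
  rewrite lerBlDr -lerBlDl; apply: lb_le_inf => // _ [r Ar <-].
  rewrite lerBlDl.
  have [h|h] := Atot _ _ Aq Ar.
  + rewrite (le_trans (Einf _ _ Ar))// (le_trans ((AS _ Ar).1.1 _ _))//.
    by rewrite lerD2r.
  + rewrite (le_trans (Einf _ _ Aq))// (le_trans ((AS _ Aq).1.1 _ _))//.
    by rewrite lerD2l.
- rewrite -ler_pdivrMl//; apply: lb_le_inf => // _ [q Aq <-].
  by rewrite ler_pdivrMl// (le_trans (Einf _ _ Aq))// (AS _ Aq).1.2.
Qed.

(* For fixed [y], the infimum over [t >= 0] of [q (z + t y) - t q y] is sublinear
   in [z] and below [q], hence equal to [q]; then take [t = 1]. *)
Lemma sublinear_min_additive q : sublinear q ->
  (forall r, sublinear r -> (forall x, r x <= q x) -> r = q) ->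
  forall x y, q (x + y) = q x + q y.
Proof.
move=> sq qmin z y.
pose E x := [set q (x + t *: y) - t * q y | t in [set t | 0 <= t]].
have E0 x : E x !=set0 by exists (q (x + 0 *: y) - 0 * q y), 0; rewrite /=.
have Elb x : has_lbound (E x).
  exists (- q (- x)) => _ [t /= t0 <-].
  have := sq.1 (x + t *: y) (- x).
  by rewrite addrAC subrr add0r sublinear_homog//; lra.
have Einf x t : 0 <= t -> inf (E x) <= q (x + t *: y) - t * q y.
  by move=> t0; apply: ge_inf => //; exists t.
have Eq : (fun x => inf (E x)) = q.
  apply: qmin => [|x]; last first.
    by have := Einf x 0 (lexx _); rewrite scale0r addr0 mul0r subr0.
  split=> [x1 x2|a x a0].
  - rewrite -lerBlDr; apply: lb_le_inf => // _ [t /= t0 <-].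
    rewrite lerBlDr -lerBlDl; apply: lb_le_inf => // _ [s /= s0 <-].
    have := Einf (x1 + x2) (t + s) (addr_ge0 t0 s0).
    have := sq.1 (x1 + t *: y) (x2 + s *: y).
    by rewrite addrACA -scalerDl; lra.
  - rewrite -ler_pdivrMl//; apply: lb_le_inf => // _ [t /= t0 <-].
    rewrite ler_pdivrMl//; have := Einf (a *: x) (a * t) (mulr_ge0 (ltW a0) t0).
    by rewrite -scalerA -scalerDr sublinear_homog ?(ltW a0)//; lra.
apply/eqP; rewrite eq_le sq.1 /=.
by have := Einf z 1 ler01; rewrite (congr1 (@^~ z) Eq) scale1r; lra.
Qed.

(** Zorn's lemma for the reversed pointwise order gives a minimal sublinear function below [p], and
    minimality forces additivity. *)
Lemma sublinear_minorant p : sublinear p ->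
  exists q, [/\ sublinear q, forall x y, q (x + y) = q x + q y
              & forall x, q x <= p x].
Proof.
move=> sp.
pose T := {q : V -> R | sublinear q /\ forall x, q x <= p x}.
pose leT (q r : T) := `[< forall x, sval r x <= sval q x >].
have [] := @Zorn T leT.
- by move=> q; apply/asboolP.
- move=> r s t /asboolP h1 /asboolP h2; apply/asboolP => x.
  exact: le_trans (h2 x) (h1 x).
- move=> [r hr] [s hs] /asboolP/= h1 /asboolP/= h2.
  apply: eq_exist; apply/funext => x; apply/eqP.
  by rewrite eq_le h1 h2.
- move=> A Atot.
  have [[q0 Aq0]|A0] := pselect (A !=set0); last first.
    exists (exist _ p (conj sp (fun x => lexx (p x)))) => s As.
    by exfalso; apply: A0; exists s.
  have [] := @sublinear_chain_inf p [set sval q | q in A].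
  + by exists (sval q0), q0.
  + by move=> _ [[q hq] _ <-].
  + move=> _ _ [q Aq <-] [r Ar <-].
    by have [/asboolP|/asboolP] := Atot _ _ Aq Ar; [left|right].
  + move=> q [hq qA]; exists (exist _ q hq) => s As; apply/asboolP => x.
    by apply: qA; exists s.
- move=> [q [sq qp]] qmin; exists q; split => //.
  apply: sublinear_min_additive => // r sr rq.
  have hr : sublinear r /\ forall x, r x <= p x.
    by split => // x; exact: le_trans (rq x) (qp x).
  by have := qmin (exist _ r hr) ltac:(exact/asboolP) => -[].
Qed.

End HahnBanach.

(** * Reiter's condition for amenable subgroups *)

Section PolyNorm.
Context (R : realType).
Implicit Types (z w : {poly R}).

(** Polynomials stand in for finitely supported real sequences; this is their l1 norm, and
    [poly_dual] is the pairing with a sequence. *)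
Definition poly_l1 z : R := \sum_(i < size z) `|z`_i|.

Lemma poly_l1E n z : (size z <= n)%N -> poly_l1 z = \sum_(i < n) `|z`_i|.
Proof.
move=> zn; rewrite /poly_l1 (big_ord_widen n (fun i => `|z`_i|))// big_mkcond.
apply: eq_bigr => i _; case: ltnP => // zi.
by rewrite nth_default// normr0.
Qed.

Lemma poly_l1_ge0 z : 0 <= poly_l1 z.
Proof. exact: sumr_ge0. Qed.

Lemma poly_l1D z w : poly_l1 (z + w) <= poly_l1 z + poly_l1 w.
Proof.
pose n := maxn (size z) (size w).
rewrite !(@poly_l1E n) ?leq_maxl ?leq_maxr ?size_polyD//.
by rewrite -big_split/= ler_sum// => i _; rewrite coefD ler_normD.
Qed.

Lemma poly_l1Z a z : poly_l1 (a *: z) = `|a| * poly_l1 z.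
Proof.
rewrite !(@poly_l1E (size z)) ?size_scale_leq// mulr_sumr.
by apply: eq_bigr => i _; rewrite coefZ normrM.
Qed.

Lemma poly_l1N z : poly_l1 (- z) = poly_l1 z.
Proof. by rewrite -scaleN1r poly_l1Z normrN1 mul1r. Qed.

Lemma poly_l1Xn n : poly_l1 'X^n = 1.
Proof.
rewrite /poly_l1 size_polyXn (bigD1 ord_max)//= coefXn eqxx normr1.
rewrite big1 ?addr0// => i ni; rewrite coefXn.
rewrite (_ : (_ == _) = false) ?normr0//.
by apply: contraNF ni => /eqP ?; apply/eqP/val_inj.
Qed.

Definition poly_dual (F : nat -> R) z : R := \sum_(i < size z) z`_i * F i.

Lemma poly_dualE F n z : (size z <= n)%N ->
  poly_dual F z = \sum_(i < n) z`_i * F i.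
Proof.
move=> zn; rewrite /poly_dual (big_ord_widen n (fun i => z`_i * F i))//.
rewrite big_mkcond; apply: eq_bigr => i _; case: ltnP => // zi.
by rewrite nth_default// mul0r.
Qed.

Lemma poly_dualD F z w : poly_dual F (z + w) = poly_dual F z + poly_dual F w.
Proof.
pose n := maxn (size z) (size w).
rewrite !(@poly_dualE _ n) ?leq_maxl ?leq_maxr ?size_polyD//.
by rewrite -big_split/=; apply: eq_bigr => i _; rewrite coefD mulrDl.
Qed.

Lemma poly_dualZ F a z : poly_dual F (a *: z) = a * poly_dual F z.
Proof.
rewrite !(@poly_dualE _ (size z)) ?size_scale_leq// mulr_sumr.
by apply: eq_bigr => i _; rewrite coefZ mulrA.
Qed.

Lemma poly_dual0 F : poly_dual F 0 = 0.
Proof. by rewrite /poly_dual size_poly0 big_ord0. Qed.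

Lemma poly_dualB F z w : poly_dual F (z - w) = poly_dual F z - poly_dual F w.
Proof. by rewrite poly_dualD -scaleN1r poly_dualZ mulN1r. Qed.

Lemma poly_dual_sum F (I : Type) (r : seq I) (f : I -> {poly R}) :
  poly_dual F (\sum_(i <- r) f i) = \sum_(i <- r) poly_dual F (f i).
Proof. exact: (big_morph _ (poly_dualD F) (poly_dual0 F)). Qed.

Lemma poly_dualXn F n : poly_dual F 'X^n = F n.
Proof.
rewrite /poly_dual size_polyXn (bigD1 ord_max)//= coefXn eqxx mul1r.
rewrite big1 ?addr0// => i ni; rewrite coefXn.
rewrite (_ : (_ == _) = false) ?mul0r//.
by apply: contraNF ni => /eqP ?; apply/eqP/val_inj.
Qed.

Lemma poly_dual_le F z : (forall i, `|F i| <= 1) -> `|poly_dual F z| <= poly_l1 z.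
Proof.
move=> F1; apply: (le_trans (ler_norm_sum _ _ _)); apply: ler_sum => i _.
by rewrite normrM ler_piMr.
Qed.

End PolyNorm.

Section Reiter.
Context (R : realType) (G : groupType).
Implicit Types (l : seq (R * G)) (T : seq G).

Definition mass l : R := \sum_(p <- l) p.1.

Definition weights_on (H : set G) l : Prop :=
  forall p, p \in l -> 0 <= p.1 /\ H p.2.

(* Finitely supported functions on [G * G] are encoded as polynomials, the pair
   [p] being represented by the monomial ['X^(code p)]. *)
Lemma countable_code : countable [set: G] ->
  exists (code : G * G -> nat) (dec : nat -> G * G), cancel code dec.
Proof.
move=> /countable_injP[f finj].
pose code (p : G * G) : nat := choice.pickle (f p.1, f p.2).
have cinj : injective code.
  move=> [a b] [c d] /(pcan_inj choice.pickleK) [/= ac bd].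
  by congr pair; apply: finj; rewrite ?inE.
exists code, (fun n => xget (1%g, 1%g) [set p | code p = n]) => p.
by apply: cinj; apply: (@xgetPex _ (1%g, 1%g) [set q | code q = code p]); exists p.
Qed.

(** [tr l] gathers the differences between [l] and its translates by each [t], in copies of [G]
    labelled by [t]. The hypothesis keeps these vectors away from 0, so a functional of norm at most
    1 separates them from 0; its values on monomials give [f]. *)
Lemma reiter_dual (H : set G) T (c : R) (code : G * G -> nat) :
  let tr l : {poly R} := \sum_(p <- l) p.1 *:
    \sum_(t <- T) ('X^(code (t, t * p.2)%g) - 'X^(code (t, p.2))) in
  (forall l, weights_on H l -> c * mass l <= poly_l1 (tr l)) ->
  exists f : G -> G -> R, (forall t x, `|f t x| <= 1) /\
    forall x, H x -> c <= \sum_(t <- T) (f t (t * x)%g - f t x).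
Proof.
move=> tr hc.
have trD l1 l2 : tr (l1 ++ l2) = tr l1 + tr l2 by rewrite /tr big_cat.
have massD l1 l2 : mass (l1 ++ l2) = mass l1 + mass l2 by rewrite /mass big_cat.
pose sc a l := [seq (a * p.1, p.2) | p <- l].
have trZ a l : tr (sc a l) = a *: tr l.
  by rewrite /tr big_map scaler_sumr; apply: eq_bigr => p _; rewrite scalerA.
have massZ a l : mass (sc a l) = a * mass l by rewrite /mass big_map mulr_sumr.
have wD l1 l2 : weights_on H l1 -> weights_on H l2 -> weights_on H (l1 ++ l2).
  by move=> h1 h2 p; rewrite mem_cat => /orP[/h1|/h2].
have wZ a l : 0 <= a -> weights_on H l -> weights_on H (sc a l).
  by move=> a0 h _ /mapP[p /h[p0 hp] ->]; split => //=; rewrite mulr_ge0.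
have w0 : weights_on H [::] by [].
(* [z |-> inf (E z)] is finite by [hc], dominated by the norm, and at most
   [- c * mass l] at [- tr l]. *)
pose E z := [set poly_l1 (z + tr l) - c * mass l | l in weights_on H].
have E0 z : E z !=set0 by exists (poly_l1 (z + tr [::]) - c * mass [::]), [::].
have Elb z : has_lbound (E z).
  exists (- poly_l1 z) => _ [l wl <-].
  have := hc l wl; have := poly_l1D (z + tr l) (- z).
  by rewrite addrAC subrr add0r poly_l1N; lra.
have Einf z l : weights_on H l -> inf (E z) <= poly_l1 (z + tr l) - c * mass l.
  by move=> wl; apply: ge_inf => //; exists l.
have Enrm z : inf (E z) <= poly_l1 z.
  by have := Einf z _ w0; rewrite /tr /mass !big_nil addr0 mulr0 subr0.
have sE : sublinear (fun z => inf (E z)).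
  split=> [x1 x2|a x a0].
  - rewrite -lerBlDr; apply: lb_le_inf => // _ [l1 wl1 <-].
    rewrite lerBlDr -lerBlDl; apply: lb_le_inf => // _ [l2 wl2 <-].
    have := Einf (x1 + x2) _ (wD _ _ wl1 wl2).
    have := poly_l1D (x1 + tr l1) (x2 + tr l2).
    by rewrite trD massD addrACA mulrDr; lra.
  - rewrite -ler_pdivrMl//; apply: lb_le_inf => // _ [l wl <-].
    rewrite ler_pdivrMl//; have := Einf (a *: x) _ (wZ _ _ (ltW a0) wl).
    by rewrite trZ massZ -scalerDr poly_l1Z gtr0_norm//; lra.
have [q [sq qD qE]] := sublinear_minorant sE.
have q0 := sublinear0 sq.
have qN z : q (- z) = - q z by have := qD z (- z); rewrite subrr q0; lra.
exists (fun t x => q 'X^(code (t, x))); split=> [t x|x Hx].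
  have h z : q z <= poly_l1 z by exact: le_trans (qE z) (Enrm z).
  have := h 'X^(code (t, x)); have := h (- 'X^(code (t, x))).
  by rewrite poly_l1N qN poly_l1Xn ler_norml; lra.
have w1 : weights_on H [:: (1, x)] by move=> p; rewrite inE => /eqP ->; split.
have := le_trans (qE (- tr [:: (1, x)])) (Einf _ _ w1).
rewrite addNr /poly_l1 size_poly0 big_ord0 qN /mass big_seq1 mulr1 sub0r lerN2.
rewrite /tr big_seq1/= scale1r (big_morph q qD q0).
by under eq_bigr do rewrite qD qN.
Qed.

End Reiter.

(** * From an invariant mean to almost invariant weights *)

Section Mean.
Context (R : realType) (G : groupType).
Implicit Types (l : seq (R * G)) (T : seq G).

Lemma fin_additive_partition (X : Type) (K : finType) (H : set X)
    (m : set X -> R) (phi : X -> K) (A : set X) :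
  (forall A B, A `<=` H -> B `<=` H -> A `&` B = set0 ->
     m (A `|` B) = m A + m B) ->
  A `<=` H -> m A = \sum_k m (A `&` [set x | phi x = k]).
Proof.
move=> mU AH.
have m0 : m set0 = 0.
  by have := mU set0 set0 (@sub0set _ _) (@sub0set _ _) (setI0 _); rewrite setU0; lra.
have key (r : seq K) : uniq r ->
    m (A `&` [set x | phi x \in r]) = \sum_(k <- r) m (A `&` [set x | phi x = k]).
  elim: r => [_|k r IH /= /andP[kr ur]].
    by rewrite big_nil -m0; congr m; apply/seteqP; split=> x //= [].
  rewrite big_cons -IH// -mU.
  - congr m; apply/seteqP; split=> x /=.
      by rewrite inE => -[Ax /orP[/eqP|]]; [left|right].
    by rewrite inE => -[[Ax ->]|[Ax ->]]; rewrite ?eqxx ?orbT.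
  - by move=> x [/AH].
  - by move=> x [/AH].
  - by apply/seteqP; split=> x //= [[_ ->] [_]]; rewrite (negPf kr).
rewrite -big_enum -key ?enum_uniq//; congr m.
by apply/seteqP; split=> x /=; [rewrite mem_enum|case].
Qed.

(** Integration against the invariant mean kills every difference, while the lower bound would
    integrate to at least [c]. *)
Lemma amenable_not_dual (H : set G) T (c : R) (f : G -> G -> R) :
  group_closed [in H] -> amenable R H -> (forall t, t \in T -> H t) ->
  (forall t x, `|f t x| <= 1) -> 0 < c ->
  ~ (forall x, H x -> c <= \sum_(t <- T) (f t (t * x)%g - f t x)).
Proof.
move=> [H1 HV] [m [mH m_ge0 mU minv]] TH f1 c0 hf.
have m0 : m set0 = 0.
  by have := mU set0 set0 (@sub0set _ _) (@sub0set _ _) (setI0 _); rewrite setU0; lra.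
have Hinv x : H x -> H x^-1%g.
  move=> Hx; have := HV 1%g x H1; rewrite !inE => /(_ Hx).
  by rewrite mul1g.
have Hmul x y : H x -> H y -> H (x * y)%g.
  move=> Hx Hy; have := HV x y^-1%g; rewrite !inE invgK; apply => //.
  exact: Hinv.
(* The values of [f] are rounded to multiples of [1 / M], so that only finitely
   many sets have to be measured. *)
pose M := (Num.truncn (((size T)%:R + 1) / c)).+1.
(* After scaling by [M], rounding costs at most 1 for each entry of [T], so a lower bound of 1
   survives. *)
have McT : (size T)%:R + 1 <= M%:R * c.
  by rewrite -ler_pdivrMr//; apply/ltW/truncnS_gt.
pose n t x := Num.truncn ((f t x + 1) * M%:R).
have nP t x : (n t x)%:R <= (f t x + 1) * M%:R < (n t x).+1%:R.
  apply: truncn_itv; rewrite mulr_ge0//; have := f1 t x.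
  by rewrite ler_norml; lra.
pose B := (2 * M)%N.
have nB t x : (n t x < B.+1)%N.
  have /andP[h _] := nP t x.
  have : (n t x)%:R <= B%:R :> R.
    apply: (le_trans h); rewrite natrM ler_wpM2r//.
    by have := f1 t x; rewrite ler_norml; lra.
  by rewrite ler_nat ltnS.
pose tt (i : 'I_(size T)) := nth 1%g T i.
have Htt i : H (tt i) by apply/TH/mem_nth.
pose pt (b : bool) i x := if b then (tt i * x)%g else x.
pose phi x : {ffun 'I_(size T) * bool -> 'I_B.+1} :=
  [ffun p => inord (n (tt p.1) (pt p.2 p.1 x))].
have phiE x p : (phi x p : nat) = n (tt p.1) (pt p.2 p.1 x).
  by rewrite ffunE inordK.
pose W k := m (H `&` [set x | phi x = k]).
have W1 : \sum_k W k = 1 by rewrite -mH (fin_additive_partition phi mU (@subset_refl _ H)).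
have W0 k : 0 <= W k by apply: m_ge0 => x [].
pose L i b j := H `&` [set x | phi x (i, b) = j].
have WL i b : \sum_k W k * (k (i, b) : nat)%:R = \sum_(j < B.+1) j%:R * m (L i b j).
  under [RHS]eq_bigr => j _.
    rewrite (fin_additive_partition phi mU (A := L i b j)) ?mulr_sumr; last by move=> x [].
    over.
  rewrite exchange_big/=; apply: eq_bigr => k _.
  rewrite (bigD1 (k (i, b)))//= big1 ?addr0 => [|j jk].
    rewrite mulrC; congr (_ * m _); apply/seteqP; split=> x /= [Hx <-] //.
    by case: Hx.
  suff -> : L i b j `&` [set x | phi x = k] = set0.
    by rewrite m0 mulr0.
  by apply/seteqP; split=> x //= [[_ /= xj] xk]; rewrite -xk xj eqxx in jk.
(* Left translation by [tt i] carries the [true] level set onto the [false] one. *)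
have mL i j : m (L i true j) = m (L i false j).
  have Hti := Hinv _ (Htt i).
  rewrite -(minv _ (L i false j) Hti); last by move=> x [].
  congr m; apply/seteqP; split=> x /=.
  - move=> [Hx xj]; exists (tt i * x)%g; last by rewrite mulKg.
    split; first exact: Hmul.
    by rewrite /= -xj; apply: val_inj; rewrite /= !phiE.
  - move=> [y [Hy yj] <-]; split; first exact: Hmul.
    by rewrite /= -yj; apply: val_inj; rewrite /= !phiE /= mulVKg.
have Wsum : \sum_k W k * \sum_i ((k (i, true) : nat)%:R - (k (i, false) : nat)%:R) = 0.
  under eq_bigr => k _ do rewrite mulr_sumr.
  rewrite exchange_big big1//= => i _.
  under eq_bigr => k _ do rewrite mulrBr.
  rewrite sumrB !WL -sumrB big1// => j _.
  by rewrite mL subrr.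
(* On a nonempty cell the rounded differences add up to at least 1, so the total mass 1 is at most
   the vanishing sum [Wsum]. *)
have : \sum_k W k <= 0; last by rewrite W1 ler10.
rewrite [leRHS](esym Wsum); apply: ler_sum => k _.
have [[x [Hx xk]]|k0] := pselect (H `&` [set x | phi x = k] !=set0); last first.
  have -> : W k = 0.
    rewrite /W; have -> : H `&` [set x | phi x = k] = set0.
      by apply/seteqP; split=> x // xk; apply: k0; exists x.
    exact: m0.
  by rewrite mul0r.
rewrite ler_peMr// -xk.
apply: (@le_trans _ _ (\sum_(t <- T) ((f t (t * x)%g - f t x) * M%:R - 1))).
  rewrite sumrB -mulr_suml big_const_seq count_predT iter_addr_0.
  have := hf x Hx; rewrite -(ler_pM2r (_ : 0 < M%:R)) ?ltr0n//.
  by rewrite [c * _]mulrC; move: McT; rewrite -lerBrDl; move=> h1 h2; lra.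
rewrite (big_nth 1%g) big_mkord; apply: ler_sum => i _.
rewrite !phiE /=; have /andP[] := nP (tt i) (tt i * x)%g; have /andP[] := nP (tt i) x.
by rewrite -!natr1 /tt; lra.
Qed.

(** If no weights on [H] had small differences, [reiter_dual] would produce functions excluded by
    [amenable_not_dual]. The l1 bound on the differences is expressed through bounded test functions
    [v]. *)
Lemma amenable_reiter (H : set G) T (e : R) : countable [set: G] ->
  group_closed [in H] -> amenable R H -> (forall t, t \in T -> H t) -> 0 < e ->
  exists l, [/\ forall p, p \in l -> 0 <= p.1, mass l = 1
    & forall (v : G -> R) t, t \in T -> (forall x, `|v x| <= 1) ->
       \sum_(p <- l) p.1 * v p.2 <= \sum_(p <- l) p.1 * v (t * p.2)%g + e].
Proof.
move=> Gc Hg Ha TH e0.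
have [code [dec cK]] := countable_code Gc.
pose U := undup T.
have UH t : t \in U -> H t by rewrite mem_undup; exact: TH.
pose tr l : {poly R} := \sum_(p <- l) p.1 *:
    \sum_(t <- U) ('X^(code (t, t * p.2)%g) - 'X^(code (t, p.2))).
have [hl|] := pselect (forall l, weights_on H l -> e * mass l <= poly_l1 (tr l)).
  have [f [f1 fx]] := reiter_dual hl.
  by have := amenable_not_dual Hg Ha UH f1 e0 fx.
move=> /existsNP[l /not_implyP[wl /negP]]; rewrite -ltNge => le.
have m0 : 0 < mass l by rewrite -(pmulr_rgt0 _ e0) (le_lt_trans _ le)// poly_l1_ge0.
exists [seq ((mass l)^-1 * p.1, p.2) | p <- l]; split.
- by move=> _ /mapP[p /wl[p0 _] ->]/=; rewrite mulr_ge0// invr_ge0 ltW.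
- by rewrite /mass big_map -mulr_sumr mulVf// gt_eqF.
- move=> v t tT v1; rewrite !big_map/=.
  (* [F] is [v] on the copy of [G] labelled [t] and vanishes on the others; as [U] has no
     repetitions, a single term of the sum survives. *)
  pose F n := if (dec n).1 == t then v (dec n).2 else 0.
  have F1 n : `|F n| <= 1 by rewrite /F; case: ifP => // _; rewrite normr0.
  have := poly_dual_le (tr l) F1; rewrite ler_norml => /andP[h _].
  have {h} : \sum_(p <- l) p.1 * v p.2 - \sum_(p <- l) p.1 * v (t * p.2)%g <= e * mass l.
    rewrite (le_trans _ (ltW le))// -lerN2 (le_trans h)//.
    rewrite poly_dual_sum -sumrB -sumrN; apply: ler_sum => p _.
    rewrite poly_dualZ poly_dual_sum (bigD1_seq t) ?mem_undup ?undup_uniq//=.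
    rewrite big1 => [|s st]; last first.
      by rewrite poly_dualB !poly_dualXn /F !cK /= (negPf st) subr0.
    by rewrite poly_dualB !poly_dualXn /F !cK /= eqxx addr0 -mulrBr -mulrN opprB.
  under eq_bigr do rewrite -mulrA.
  under [X in _ -> _ <= X + _]eq_bigr do rewrite -mulrA.
  rewrite -!mulr_sumr -lerBlDl -mulrBr => h.
  by rewrite ler_pdivrMl// mulrC.
Qed.

End Mean.

(** * Almost harmonic functions *)

Section Averages.
Context (R : realType) (G : groupType).
Implicit Types (l : seq (R * G)) (u v w : G -> R) (x g s : G).

(** The Markov operator of the right random walk with step distribution [l]. An element may occur
    several times in [l]; [weight] adds up its occurrences. *)
Definition average l v x : R := \sum_(p <- l) p.1 * v (x * p.2)%g.

Definition weight l g : R := \sum_(p <- l) p.1 * (p.2 == g)%:R.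

Definition nonneg_weights l : Prop := forall p, p \in l -> 0 <= p.1.

Lemma weight_ge0 l g : nonneg_weights l -> 0 <= weight l g.
Proof.
by move=> l0; rewrite /weight big_seq sumr_ge0// => p /l0 p0; rewrite mulr_ge0.
Qed.

Lemma average_le l u v x : nonneg_weights l ->
  (forall p, p \in l -> u (x * p.2)%g <= v (x * p.2)%g) ->
  average l u x <= average l v x.
Proof.
move=> l0 uv; rewrite /average big_seq [leRHS]big_seq; apply: ler_sum => p pl.
by rewrite ler_wpM2l ?l0 ?uv.
Qed.

Lemma average_ge0 l u x : nonneg_weights l -> (forall y, 0 <= u y) ->
  0 <= average l u x.
Proof.
by move=> l0 u0; rewrite /average big_seq sumr_ge0// => p pl; rewrite mulr_ge0 ?l0.
Qed.

Lemma averageD l u v x : average l (u \+ v) x = average l u x + average l v x.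
Proof. by rewrite /average -big_split/=; apply: eq_bigr => p _; rewrite mulrDr. Qed.

Lemma averageZ l a u x : average l (fun y => a * u y) x = a * average l u x.
Proof. by rewrite /average mulr_sumr; apply: eq_bigr => p _; rewrite mulrCA. Qed.

Lemma average_cst l a x : average l (fun=> a) x = mass l * a.
Proof. by rewrite /average mulr_suml. Qed.

(* [green l n] is the truncated Green operator, the sum of the first [n] powers
   of [average l]; [reach l n x] lists the points its value at [x] depends on. *)
Fixpoint green l n v x : R :=
  if n is n'.+1 then v x + average l (green l n' v) x else 0.

Fixpoint reach l n x : seq G :=
  if n is n'.+1 then x :: flatten [seq reach l n' (x * p.2)%g | p <- l]
  else [::].

Lemma green_le l n u v x : nonneg_weights l ->
  (forall y, y \in reach l n x -> u y <= v y) -> green l n u x <= green l n v x.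
Proof.
move=> l0; elim: n x => //= n IH x uv; apply: lerD.
  by apply: uv; rewrite inE eqxx.
apply: average_le => // p pl; apply: IH => y yr; apply: uv.
rewrite inE; apply/orP; right; apply/flattenP.
by exists (reach l n (x * p.2)%g) => //; apply: map_f.
Qed.

Lemma greenD l n u v x : green l n (u \+ v) x = green l n u x + green l n v x.
Proof.
elim: n x => /= [|n IH] x; first by rewrite addr0.
rewrite addrACA -averageD; congr (_ + _).
by apply: eq_bigr => p _; rewrite IH.
Qed.

Lemma greenZ l n a u x : green l n (fun y => a * u y) x = a * green l n u x.
Proof.
elim: n x => /= [|n IH] x; first by rewrite mulr0.
rewrite mulrDr -averageZ; congr (_ + _).
by apply: eq_bigr => p _; rewrite IH.
Qed.

Lemma green0 l n x : green l n (fun=> 0) x = 0.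
Proof.
elim: n x => //= n IH x; rewrite add0r /average big1// => p _.
by rewrite IH mulr0.
Qed.

Lemma green_sum l n (I : Type) (r : seq I) (f : I -> G -> R) x :
  green l n (fun y => \sum_(i <- r) f i y) x = \sum_(i <- r) green l n (f i) x.
Proof.
elim: r => [|i r IH].
  by rewrite big_nil -[RHS](green0 l n x); congr green; apply/funext => y; rewrite big_nil.
rewrite big_cons -IH -greenD; congr green.
by apply/funext => y; rewrite big_cons.
Qed.

Lemma green_translate l n u s x :
  green l n (fun y => u (s * y)%g) x = green l n u (s * x)%g.
Proof.
elim: n x => //= n IH x; congr (_ + _); apply: eq_bigr => p _.
by rewrite IH mulgA.
Qed.

Lemma green_cst l n x : (1 - mass l) * green l n (fun=> 1) x = 1 - mass l ^+ n.
Proof.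
elim: n x => /= [|n IH] x; first by rewrite mulr0 expr0 subrr.
rewrite mulrDr -averageZ.
under [X in _ + X]eq_bigr do rewrite IH.
by rewrite -/(average l (fun=> 1 - mass l ^+ n) x) average_cst exprS; ring.
Qed.

Section AlmostHarmonic.
Context (sig lam : seq (R * G)) (u : G -> R) (k : R).
Hypotheses (sig0 : nonneg_weights sig) (sig1 : mass sig <= 1).
Hypotheses (u0 : forall x, 0 <= u x) (u1 : forall x, u x <= 1).
Hypothesis (k0 : 0 <= k).
Let w x := (1 - mass sig) * average lam u x.
Hypothesis uharm : forall x, `|u x - (average sig u x + w x)| <= k.

Let mass_ge0 : 0 <= mass sig.
Proof. by rewrite /mass big_seq sumr_ge0. Qed.

(** Iterating almost harmonicity [n] times leaves the [n]-fold average of [u], at most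
    [mass sig ^+ n] since [u <= 1], and each round adds an error of at most [k]. For the lower bound
    below, this remainder is nonnegative and is dropped. *)
Lemma almost_harmonic_ub n x :
  u x <= green sig n w x + (mass sig ^+ n + n%:R * k).
Proof.
elim: n x => /= [|n IH] x; first by rewrite expr0 mul0r addr0 add0r.
have := uharm x; rewrite ler_norml => /andP[_ h].
have h1 : average sig u x <= average sig (green sig n w) x
    + mass sig * (mass sig ^+ n + n%:R * k).
  rewrite -(average_cst sig (mass sig ^+ n + n%:R * k) x) -averageD.
  by apply: average_le => // p _; exact: IH.
have h2 : mass sig * (n%:R * k) <= n%:R * k.
  by rewrite ler_piMl// mulr_ge0.
by move: h1; rewrite exprS -[n.+1]addn1 natrD; lra.
Qed.

Lemma almost_harmonic_lb n x : green sig n w x <= u x + n%:R * k.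
Proof.
elim: n x => /= [|n IH] x; first by rewrite mul0r addr0.
have := uharm x; rewrite ler_norml => /andP[h _].
have h1 : average sig (green sig n w) x <= average sig u x + mass sig * (n%:R * k).
  rewrite -(average_cst sig (n%:R * k) x) -averageD.
  by apply: average_le => // p _; exact: IH.
have h2 : mass sig * (n%:R * k) <= n%:R * k.
  by rewrite ler_piMl// mulr_ge0.
by move: h1; rewrite -[n.+1]addn1 natrD; lra.
Qed.

(** The Green operator, times [1 - mass sig], is applied to the hypothesis: it sees only
    [reach sig n x], commutes with left translations, and sends 1 to [1 - mass sig ^+ n]. The two
    preceding bounds lead back from [green sig n w] to [u]. *)
Lemma almost_harmonic_separation (S : seq G) (n : nat) (x : G) :
  (forall y, y \in reach sig n x ->
     2^-1 <= 1 - average lam u y + \sum_(s <- S) average lam u (s * y)%g) ->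
  2^-1 * (1 - mass sig ^+ n) <=
    1 - u x + \sum_(s <- S) u (s * x)%g + (size S).+1%:R * (n%:R * k).
Proof.
move=> hr.
have hF : 2^-1 * (1 - mass sig ^+ n) <= (1 - mass sig ^+ n) - green sig n w x
    + \sum_(s <- S) green sig n w (s * x)%g.
  rewrite -(green_cst sig n x) mulrCA -greenZ mulr1.
  apply: le_trans (_ : (1 - mass sig) * green sig n (fun y => 1 - average lam u y +
     \sum_(s <- S) average lam u (s * y)%g) x <= _).
    by rewrite ler_wpM2l ?subr_ge0//; exact: green_le.
  rewrite /w !greenZ.
  under [in leRHS]eq_bigr do rewrite greenZ.
  rewrite -mulr_sumr -mulrBr -mulrDr ler_wpM2l ?subr_ge0//.
  rewrite (greenD _ _ (fun y => 1 - average lam u y)) green_sum.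
  rewrite (greenD _ _ (fun=> 1) (fun y => - average lam u y)).
  rewrite (_ : green sig n (fun y => - average lam u y) x = - green sig n (average lam u) x).
    by under eq_bigr do rewrite green_translate.
  rewrite -mulN1r -greenZ; congr green; apply/funext => y; by rewrite mulN1r.
have h1 := almost_harmonic_ub n x.
have h2 : \sum_(s <- S) green sig n w (s * x)%g <=
    \sum_(s <- S) u (s * x)%g + (size S)%:R * (n%:R * k).
  rewrite mulr_natl -[X in _ *+ X]count_predT -iter_addr_0 -big_const_seq -big_split/=.
  by apply: ler_sum => s _; exact: almost_harmonic_lb.
by move: hF h1 h2; rewrite -[(size S).+1]addn1 natrD mulrDl mul1r; lra.
Qed.

End AlmostHarmonic.

Definition symmetric_weights l : Prop := forall g, weight l g = weight l g^-1%g.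

(** As [S] and [Y] are finite, only finitely many conjugates [s ^ y] in [H] have to be almost
    preserved, so one [lam] serves all [u] and [y]. *)
Lemma visible_weights (S Y : seq G) : countable [set: G] ->
  amenably_visible R [set` S] ->
  exists lam, [/\ nonneg_weights lam, mass lam = 1, symmetric_weights lam
    & forall u, (forall x, 0 <= u x <= 1) -> forall y, y \in Y ->
      2^-1 <= 1 - average lam u y + \sum_(s <- S) average lam u (s * y)%g].
Proof.
move=> Gc [H [Hg Ha SH]].
pose T := [seq t <- [seq (s ^ y)%g | s <- S, y <- Y] | t \in H].
have TH t : t \in T -> H t by rewrite mem_filter => /andP[/set_mem].
have h2 : 0 < (2^-1 : R) by rewrite invr_gt0.
have [l [l0 l1 lT]] := amenable_reiter Gc Hg Ha TH h2.
(* [rho * rho^check] is symmetric and still almost left-invariant. *)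
pose lam := [seq (p.1 * q.1, (p.2 * q.2^-1)%g) | p <- l, q <- l].
have lamE (f : G -> R) : \sum_(p <- lam) p.1 * f p.2 =
    \sum_(p <- l) p.1 * \sum_(q <- l) q.1 * f (p.2 * q.2^-1)%g.
  rewrite /lam big_allpairs_dep/=; apply: eq_bigr => p _.
  by rewrite mulr_sumr; apply: eq_bigr => q _; rewrite mulrA.
have lam0 : nonneg_weights lam.
  by move=> _ /allpairsP[[p q] [/l0 p0 /l0 q0 ->]] /=; rewrite mulr_ge0.
exists lam; split => //.
- rewrite /mass (eq_bigr (fun p => p.1 * 1)) => [|p _]; last by rewrite mulr1.
  rewrite (lamE (fun=> 1)) (eq_bigr fst) => [|p _]; first exact: l1.
  by rewrite -mulr_suml -/(mass l) l1 !mulr1.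
- move=> g; rewrite /weight.
  rewrite (lamE (fun x => (x == g)%:R)) (lamE (fun x => (x == g^-1%g)%:R)).
  under eq_bigr do rewrite mulr_sumr.
  rewrite exchange_big/=; apply: eq_bigr => q _; rewrite mulr_sumr.
  apply: eq_bigr => p _; rewrite mulrCA; congr (_ * (_ * (nat_of_bool _)%:R)).
  by rewrite -(inj_eq invg_inj) invgM invgK.
- move=> u u01 y yY.
  (* Visibility at [y^-1] gives [s] as the conjugate of [h] by [y^-1], that is, [s ^ y = h]. *)
  have [s [Ss [h Hh hs]]] := SH y^-1%g.
  have sy : H (s ^ y)%g by rewrite -hs -conjgM mulVg conjg1.
  have syT : (s ^ y)%g \in T.
    rewrite mem_filter; apply/andP; split; first exact/mem_set.
    by apply/allpairsP; exists (s, y).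
  have avE x : average lam u x =
      \sum_(p <- l) p.1 * \sum_(q <- l) q.1 * u (x * (p.2 * q.2^-1))%g.
    exact: lamE (fun g => u (x * g)%g).
  (* The test function absorbs the second factor of [lam]; translating its argument by [s ^ y]
     replaces [y] by [s * y]. *)
  pose v h := \sum_(q <- l) q.1 * u (y * (h * q.2^-1))%g.
  have v1 x : `|v x| <= 1.
    rewrite ger0_norm; last first.
      rewrite /v big_seq sumr_ge0// => q ql; rewrite mulr_ge0 ?l0//.
      by case/andP: (u01 (y * (x * q.2^-1))%g).
    rewrite -l1 /v /mass big_seq [leRHS]big_seq; apply: ler_sum => q ql.
    by rewrite ler_piMr ?l0//; case/andP: (u01 (y * (x * q.2^-1))%g).
  have := lT v _ syT v1; rewrite -/(average _ _ _) => hv.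
  have {}hv : average lam u y <= average lam u (s * y)%g + 2^-1.
    rewrite avE (le_trans hv)// lerD2r avE le_eqVlt; apply/orP; left; apply/eqP.
    apply: eq_bigr => p _; congr (_ * _); apply: eq_bigr => q _.
    by rewrite conjgE !mulgA mulgV mul1g.
  have : average lam u (s * y)%g <= \sum_(s <- S) average lam u (s * y)%g.
    rewrite (big_rem s)//= lerDl sumr_ge0// => t _.
    by apply: average_ge0 => // x; case/andP: (u01 x).
  lra.
Qed.

End Averages.

(** * Perturbation of measures in the l1 distance *)

Lemma measure_countable_partition (R : realType) (X : choiceType) d
    (T : measurableType d) (mu : {measure set T -> \bar R}) (f : T -> X)
    (A : set T) :
  countable [set: X] -> (forall g, measurable (f @^-1` [set g])) ->
  measurable A -> mu A = (\esum_(g in [set: X]) mu (A `&` f @^-1` [set g]))%E.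
Proof.
move=> /countable_injP[e einj] mf mA.
(* Each [J n] has at most one element, which turns the sum over [X] into a series. *)
pose J n := e @^-1` [set n].
pose H n := A `&` \bigcup_(g in J n) (f @^-1` [set g]).
have Jsub n g : J n g -> J n = [set g].
  move=> <-; apply/seteqP; split=> x /= ; last by move=> ->.
  by rewrite /J /= => exg; apply: einj; rewrite ?inE.
have J01 n : J n = set0 \/ exists g, J n = [set g].
  have [[g /Jsub ->]|h] := pselect (J n !=set0); first by right; exists g.
  by left; apply: contrapT => /eqP/set0P.
have mH n : measurable (H n).
  apply: measurableI => //; have [->|[g ->]] := J01 n.
    by rewrite bigcup_set0.
  by rewrite bigcup_set1.
have -> : [set: X] = \bigcup_(n in [set: nat]) J n.
  by apply/seteqP; split=> // g _; exists (e g).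
rewrite esum_bigcupT//; last first.
  by move=> i j _ _ [g [<- <-]].
rewrite [in LHS](_ : A = \bigcup_n H n); last first.
  apply/seteqP; split=> [x Ax|x [n _ []]//].
  by exists (e (f x)) => //; split => //; exists (f x).
rewrite measure_semi_bigcup//; last exact: bigcup_measurable.
  rewrite nneseries_esumT//; apply: eq_esum => n _.
  rewrite /H; have [->|[g ->]] := J01 n.
    by rewrite bigcup_set0 setI0 measure0 esum_set0.
  by rewrite bigcup_set1 esum_set1.
by move=> i j _ _ [x [[_ [g <- /= <-]] [_ [g' <- /= <-]]]].
Qed.

Section Genericity.
Context (R : realType) (G : groupType).
Implicit Types (nu : prob_measures R G) (W : set (prob_measures R G)).

Lemma l1dist_nbhsP nu W : nbhs nu W <->
  exists2 e : R, 0 < e & forall nu', (l1dist nu nu' < e%:E)%E -> W nu'.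
Proof. by split=> [/nbhs_ballP[e e0 h]|[e e0 h]]; [exists e|apply/nbhs_ballP; exists e]. Qed.

(** The interiors of the [W n] are dense in both spaces at once, since the approximating [nu] is
    symmetric whenever [nu0] is. *)
Lemma residual_robust (W : nat -> set (prob_measures R G)) :
  (forall n nu0 (e : R), 0 < e -> exists nu,
    [/\ (l1dist nu0 nu < e%:E)%E, symmetric_measures nu0 -> symmetric_measures nu
      & nbhs nu (W n)]) ->
  residual (\bigcap_n W n) /\
  residual [set nu : set_type (symmetric_measures (R := R) (G := G)) |
              (\bigcap_n W n) (set_val nu)].
Proof.
move=> hW; split.
- exists (fun n => interior (W n)); split=> [n|nu h n _]; last first.
    by apply: interior_subset; exact: h.
  split; first exact: open_interior.
  move=> O [nu0 Onu0] oO.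
  have /l1dist_nbhsP[e e0 he] : nbhs nu0 O by exact: open_nbhs_nbhs.
  have [nu [d _ hn]] := hW n nu0 e e0.
  by exists nu; split; [exact: he|].
- exists (fun n => set_val @^-1` (interior (W n))).
  split=> [n|nu h n _]; last by apply: interior_subset; exact: h.
  split; first by exists (interior (W n)) => //; exact: open_interior.
  move=> O [[nu0 snu0] Onu0] [V oV VO].
  have Vnu0 : V nu0 by move: Onu0; rewrite -VO.
  have /l1dist_nbhsP[e e0 he] : nbhs nu0 V by exact: open_nbhs_nbhs.
  have [nu [d s hn]] := hW n nu0 e e0.
  have snu : nu \in symmetric_measures (R := R) (G := G).
    by apply/mem_set/s; exact: set_mem.
  exists (exist _ nu snu); split; last exact: hn.
  by rewrite -VO; exact: he.
Qed.

Lemma prob_measure_esum nu : countable [set: G] ->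
  (\esum_(g in [set: discr G]) nu [set g] = 1)%E.
Proof.
move=> Gc; rewrite -(@probability_setT _ _ _ (nu : probability (discr G) R)).
rewrite (@measure_countable_partition _ _ _ (discr G) nu id setT Gc)//.
by apply: eq_esum => g _; rewrite setTI.
Qed.

Lemma esum_weight (l : seq (R * G)) (f : G -> R) : nonneg_weights l ->
  (forall g, 0 <= f g) ->
  (\esum_(g in [set: G]) (weight l g * f g)%:E = (\sum_(p <- l) p.1 * f p.2)%:E)%E.
Proof.
move=> + f0; elim: l => [|p l IH] l0.
  rewrite esum1 ?big_nil// => g _.
  by rewrite /weight big_nil mul0r.
have p0 : 0 <= p.1 by apply: l0; rewrite inE eqxx.
have {}l0 : nonneg_weights l by move=> q ql; apply: l0; rewrite inE ql orbT.
rewrite big_cons EFinD -IH//.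
under eq_esum do rewrite /weight big_cons mulrDl EFinD.
rewrite esumD; last 2 first.
- by move=> g _; rewrite lee_fin !mulr_ge0.
- by move=> g _; rewrite lee_fin mulr_ge0// weight_ge0.
congr (_ + _)%E.
rewrite -(@esum_set1 _ _ p.2 (fun g => (p.1 * f g)%:E)) ?lee_fin ?mulr_ge0//.
rewrite [RHS]esum_mkcond; apply: eq_esum => g _.
rewrite in_set1 eq_sym; case: eqP => _; rewrite ?mulr1 ?mulr0 ?mul0r//.
Qed.

(** The absolute value supplies the nonnegative factor of [mscale] for every list; it disappears on
    nonnegative weights. *)
Definition weights_msum (l : seq (R * G)) : set (discr G) -> \bar R :=
  msum (fun k => mscale (NngNum (normr_ge0 (nth (0, 1%g) l k).1))
                   (dirac ((nth (0, 1%g) l k).2 : discr G))) (size l).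

HB.instance Definition _ l := Measure.on (weights_msum l).

Lemma weights_msumE (l : seq (R * G)) (A : set (discr G)) : nonneg_weights l ->
  weights_msum l A = (\sum_(p <- l) p.1 * (p.2 \in A)%:R)%:E.
Proof.
move=> l0; rewrite /weights_msum /= /msum (big_nth (0, 1%g)) big_mkord -sumEFin.
apply: eq_bigr => k _; rewrite /=.
set p := nth (0, 1%g) l k.
change (`|p.1|%:E * dirac (p.2 : discr G) A = (p.1 * (p.2 \in A)%:R)%:E)%E.
rewrite diracE -EFinM ger0_norm//.
by apply: l0; exact: mem_nth.
Qed.

Lemma weights_measure (l : seq (R * G)) : nonneg_weights l -> mass l = 1 ->
  exists nu, forall g : discr G, nu [set g] = (weight l g)%:E.
Proof.
move=> l0 l1.
have m1 : weights_msum l setT = 1%E.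
  rewrite weights_msumE// -[RHS](congr1 EFin l1); congr EFin.
  by apply: eq_bigr => p _; rewrite in_setT mulr1.
pose P := Measure_isProbability.Build _ _ _ (weights_msum l) m1.
pose nu : probability (discr G) R := HB.pack (weights_msum l) P.
exists nu => g; rewrite /nu /= weights_msumE//; congr EFin; apply: eq_bigr => p _.
by rewrite in_set1.
Qed.

(** A finite part of [nu0] of mass close to 1 is shrunk by the factor [1 - d], so that its mass is
    below 1 even when [nu0] has finite support. *)
Lemma weights_approx nu0 (e : R) : countable [set: G] -> 0 < e ->
  exists sig : seq (R * G), [/\ nonneg_weights sig, mass sig < 1, 1 - mass sig < e,
    forall g : discr G, ((weight sig g)%:E <= nu0 [set g])%E
    & symmetric_measures nu0 -> symmetric_weights sig].
Proof.
move=> Gc e0.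
pose f (g : G) : R := fine (nu0 [set (g : discr G)]).
have fE (g : G) : nu0 [set (g : discr G)] = (f g)%:E by rewrite fineK// fin_num_measure.
have f0 g : 0 <= f g by rewrite fine_ge0.
have fsum (X : seq G) : uniq X ->
    (\sum_(g \in [set` X]) nu0 [set g])%E = (\sum_(g <- X) f g)%:E.
  move=> uX; rewrite -fsbig_seq//= -sumEFin; apply: eq_bigr => g _; exact: fE.
have fsum1 (X : seq G) : uniq X -> \sum_(g <- X) f g <= 1.
  move=> uX; rewrite -lee_fin -fsum// -(prob_measure_esum nu0 Gc).
  apply: ereal_sup_ubound; exists [set` X]; last by [].
  by split; [exact: finite_seq|].
(* The mass of [sig] will exceed [(1 - d) ^+ 2], which is at least [1 - 2 * d], hence at least
   [1 - e]. *)
pose d := Num.min (e / 2) 2^-1.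
have d0 : 0 < d by rewrite lt_min divr_gt0//= invr_gt0.
have [d1 de] : d <= 2^-1 /\ d <= e / 2 by rewrite /d !ge_min !lexx orbT.
have : ((1 - d)%:E < \esum_(g in [set: discr G]) nu0 [set g])%E.
  by rewrite prob_measure_esum// lte_fin; lra.
move=> /ereal_sup_gt[_ [X [fX _] <-]] hX.
(* Closing the support under inversion lets [sig] inherit symmetry. *)
pose Y : seq G := undup (fset_set X ++ [seq g^-1%g | g <- fset_set X] : seq G).
have uY : uniq Y by exact: undup_uniq.
have YV g : (g^-1%g \in Y) = (g \in Y).
  have h (x : G) : (x^-1%g \in [seq y^-1%g | y <- fset_set X : seq G]) = (x \in fset_set X).
    by rewrite (mem_map invg_inj).
  by rewrite !mem_undup !mem_cat orbC h -[g^-1%g \in _]h invgK.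
have hY : 1 - d < \sum_(g <- Y) f g.
  have : 1 - d < \sum_(g <- fset_set X) f g.
    move: hX; rewrite fsbig_finite//= -lte_fin -sumEFin.
    by under eq_bigr do rewrite fE.
  move=> /lt_le_trans; apply.
  rewrite (_ : \sum_(g <- fset_set X) f g = \sum_(g <- Y | g \in fset_set X) f g).
    by rewrite [leLHS]big_mkcond; apply: ler_sum => g _; case: ifP.
  rewrite -[RHS]big_filter; apply: perm_big; apply: uniq_perm.
  - exact: fset_uniq.
  - exact: filter_uniq.
  - by move=> g; rewrite mem_filter mem_undup mem_cat; case: (g \in _).
pose sig : seq (R * G) := [seq ((1 - d) * f g, g) | g <- Y].
have sigE h : \sum_(p <- sig) p.1 * h p.2 = (1 - d) * \sum_(g <- Y) f g * h g.
  by rewrite /sig big_map mulr_sumr; apply: eq_bigr => g _; rewrite mulrA.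
have massE : mass sig = (1 - d) * \sum_(g <- Y) f g.
  by rewrite /mass /sig big_map mulr_sumr.
have wE g : weight sig g = (1 - d) * (if g \in Y then f g else 0).
  rewrite /weight (sigE (fun x => (x == g)%:R)); congr (_ * _).
  case: ifPn => gY.
    rewrite (bigD1_seq g)//= eqxx mulr1 big1 ?addr0// => h /negPf ->.
    by rewrite mulr0.
  rewrite big_seq big1// => h hY'; case: eqP => [hg|_]; last by rewrite mulr0.
  by rewrite -hg hY' in gY.
exists sig; split.
- by move=> _ /mapP[g _ ->]; rewrite mulr_ge0//=; lra.
- have := fsum1 _ uY; rewrite massE => h; nra.
- have := fsum1 _ uY; rewrite massE => h; nra.
- move=> g; rewrite wE fE lee_fin; case: ifP => _; last by rewrite mulr0.
  by rewrite ler_piMl//; lra.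
- move=> snu g; rewrite !wE YV; congr (_ * _); case: ifP => // _.
  by rewrite /f snu.
Qed.

(** The deficit [1 - mass sig], less than [e / 2], is refilled by [lam] and so counts at most twice
    in the distance. [lam] is quantified after [sig] because it will depend on the points reached by
    [sig]. *)
Lemma perturbation nu0 (e : R) : countable [set: G] -> 0 < e ->
  exists sig : seq (R * G), [/\ nonneg_weights sig, mass sig < 1 &
    forall lam : seq (R * G), nonneg_weights lam -> mass lam = 1 -> symmetric_weights lam ->
    exists nu, [/\ (l1dist nu0 nu < e%:E)%E,
      symmetric_measures nu0 -> symmetric_measures nu &
      forall g : discr G,
        nu [set g] = (weight sig g + (1 - mass sig) * weight lam g)%:E]].
Proof.
move=> Gc e0; have e2 : 0 < e / 2 by rewrite divr_gt0.
have [sig [sig0 sig1 sige sigle sigs]] := weights_approx nu0 Gc e2.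
exists sig; split => // lam lam0 lam1 lams.
pose l := sig ++ [seq ((1 - mass sig) * p.1, p.2) | p <- lam].
have l0 : nonneg_weights l.
  move=> p; rewrite mem_cat => /orP[/sig0//|/mapP[q /lam0 q0 ->]].
  by rewrite mulr_ge0//=; lra.
have l1 : mass l = 1.
  rewrite /mass big_cat big_map /= -mulr_sumr.
  by rewrite -/(mass sig) -/(mass lam) lam1; ring.
have wl g : weight l g = weight sig g + (1 - mass sig) * weight lam g.
  rewrite /weight big_cat big_map /= mulr_sumr; congr (_ + _).
  by apply: eq_bigr => p _; rewrite mulrA.
have [nu nuE] := weights_measure l0 l1.
exists nu; split.
- pose f (g : G) : R := fine (nu0 [set (g : discr G)]).
  have fE (g : G) : nu0 [set (g : discr G)] = (f g)%:E by rewrite fineK// fin_num_measure.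
  have fw g : weight sig g <= f g by rewrite -lee_fin -fE.
  have esumw (k : seq (R * G)) : nonneg_weights k ->
      (\esum_(g in [set: G]) (weight k g)%:E)%E = (mass k)%:E.
    move=> k0; rewrite /mass (eq_bigr (fun p => p.1 * 1)) => [|p _]; last by rewrite mulr1.
    rewrite -(esum_weight k0 (f := fun=> 1))//.
    by apply: eq_esum => g _; rewrite mulr1.
  have h1 : (\esum_(g in [set: G]) (f g - weight sig g)%:E = (1 - mass sig)%:E)%E.
    have := prob_measure_esum nu0 Gc.
    under eq_esum => g _ do rewrite fE -(subrK (weight sig g) (f g)) EFinD.
    rewrite esumD; last 2 first.
    - by move=> g _; rewrite lee_fin subr_ge0.
    - by move=> g _; rewrite lee_fin weight_ge0.
    rewrite [X in (_ + X)%E](esumw _ sig0) => h.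
    by rewrite EFinB -h addeK.
  apply: (@le_lt_trans _ _ (\esum_(g in [set: G]) ((f g - weight sig g)%:E +
     ((1 - mass sig) * weight lam g)%:E))%E).
    apply: le_esum => g _; rewrite nuE wl fE -EFinB abse_EFin -EFinD lee_fin.
    rewrite opprD addrA (le_trans (ler_normB _ _))//.
    by rewrite !ger0_norm ?subr_ge0// mulr_ge0 ?weight_ge0//; lra.
  rewrite esumD; last 2 first.
  - by move=> g _; rewrite lee_fin subr_ge0.
  - by move=> g _; rewrite lee_fin mulr_ge0 ?weight_ge0//; lra.
  rewrite h1; under [X in (_ + X)%E]eq_esum do rewrite mulrC.
  rewrite (esum_weight lam0) => [|_]; last lra.
  by rewrite -mulr_suml -/(mass lam) lam1 -EFinD lte_fin; lra.
- move=> /sigs ss g; rewrite !nuE !wl lams; congr (_ + _)%:E.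
  by rewrite ss.
- by move=> g; rewrite nuE wl.
Qed.

End Genericity.

(** * The Markov property of the random walk *)

Lemma countable_seq (T : Type) : countable [set: T] -> countable [set: seq T].
Proof.
move=> /countable_injP[f finj]; apply/countable_injP.
exists (fun s => choice.pickle (map f s)) => s t _ _ /(pcan_inj choice.pickleK).
by apply: inj_map => x y; apply: finj; rewrite inE.
Qed.

Section Paths.
Context (G : groupType).
Implicit Types (g x : G) (l : seq G) (w : paths G) (B : set (paths G)).

Definition prefix_set l : set (paths G) :=
  [set w | forall i, (i < size l)%N -> w i = nth 1%g l i].

Definition depends_on_prefix (n : nat) B : Prop :=
  forall w w', (forall i, (i < n)%N -> w i = w' i) -> B w -> B w'.

Definition cons_path x w : paths G := fun n => if n is m.+1 then w m else x.

Lemma measurable_coordinate n : measurable_fun [set: paths G] (fun w : paths G => w n).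
Proof.
move=> _ B _; rewrite setTI; apply: sub_sigma_algebra.
by exists n, B.
Qed.

Lemma measurable_paths d (T : measurableType d) (f : T -> paths G) :
  (forall n, measurable_fun [set: T] (fun t => f t n)) ->
  measurable_fun [set: T] f.
Proof.
move=> mf; apply: (@measurability _ _ T (paths G) setT f (@cylinders G))
  => [//|_ [_ [n [B ->]] <-]].
by have := mf n measurableT B I; rewrite setTI.
Qed.

Lemma measurable_shift : measurable_fun [set: paths G] (@Defs.shift G).
Proof. by apply: measurable_paths => n; exact: measurable_coordinate. Qed.

Lemma measurable_translate g : measurable_fun [set: paths G] (translate g).
Proof.
apply: measurable_paths => n.
apply: (@measurableT_comp _ _ _ _ (discr G) (discr G) (fun x => (g * x)%g : discr G)) => //.
exact: measurable_coordinate.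
Qed.

Lemma measurable_cons_path x : measurable_fun [set: paths G] (cons_path x).
Proof.
by apply: measurable_paths => -[|n]; [exact: measurable_cst|exact: measurable_coordinate].
Qed.

Lemma measurable_preimage d (T : measurableType d) d' (T' : measurableType d')
    (f : T -> T') (A : set T') :
  measurable_fun [set: T] f -> measurable A -> measurable (f @^-1` A).
Proof. by move=> mf mA; have := mf measurableT A mA; rewrite setTI. Qed.

Lemma prefix_set_cons x l :
  prefix_set (x :: l) = [set w | w 0%N = x] `&` @Defs.shift G @^-1` prefix_set l.
Proof.
apply/seteqP; split=> [w h|w [h0 h] [|i]//]; last exact: h.
by split=> [|i il]; [exact: (h 0%N)|exact: (h i.+1)].
Qed.

Lemma prefix_set_nil : prefix_set [::] = setT.
Proof. exact/seteqP. Qed.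

Lemma measurable_first x : measurable [set w : paths G | w 0%N = x].
Proof.
rewrite -[X in measurable X]setTI.
exact: (@measurable_coordinate 0%N measurableT [set (x : discr G)] I).
Qed.

Lemma measurable_prefix_set l : measurable (prefix_set l).
Proof.
elim: l => [|x l IH]; first by rewrite prefix_set_nil.
rewrite prefix_set_cons; apply: measurableI; first exact: measurable_first.
exact: (measurable_preimage measurable_shift).
Qed.

Lemma prefix_setI l l' :
  [\/ prefix_set l `&` prefix_set l' = set0,
      prefix_set l `&` prefix_set l' = prefix_set l
    | prefix_set l `&` prefix_set l' = prefix_set l'].
Proof.
elim: l l' => [|x l IH] [|y l']; rewrite ?prefix_set_nil ?setIT ?setTI;
  [exact: Or33|exact: Or33|exact: Or32|].
rewrite !prefix_set_cons.
have [<-|xy] := eqVneq x y.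
  rewrite -setIIr -preimage_setI.
  case: (IH l') => ->; [apply: Or31|exact: Or32|exact: Or33].
  by rewrite preimage_set0 setI0.
apply: Or31; apply/seteqP; split=> w //= [[w0 _] [w0' _]].
by rewrite -w0 w0' eqxx in xy.
Qed.

Lemma depends_on_prefixI n B l : depends_on_prefix n B -> size l = n ->
  B `&` prefix_set l = set0 \/ B `&` prefix_set l = prefix_set l.
Proof.
move=> dB ln; have [[w [Bw wl]]|h] := pselect (B `&` prefix_set l !=set0).
  right; apply/seteqP; split=> [w' []//|w' w'l]; split => //.
  apply: dB Bw => i i_n; rewrite wl ?ln// w'l ?ln//.
left; by apply: contrapT => /eqP/set0P.
Qed.

Lemma depends_on_prefix_bigcup n B : depends_on_prefix n B ->
  B = \bigcup_l (if `[< size l = n /\ prefix_set l `<=` B >] then prefix_set l else set0).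
Proof.
move=> dB; apply/seteqP; split=> [w Bw|w [l _]]; last by case: asboolP => // -[_]; apply.
exists (mkseq w n) => //.
have wm : prefix_set (mkseq w n) w by move=> i; rewrite size_mkseq => i_n; rewrite nth_mkseq.
case: asboolP => // -[]; split; first by rewrite size_mkseq.
move=> w' w'm; apply: dB Bw => i i_n.
by rewrite w'm ?size_mkseq// nth_mkseq.
Qed.

(** Coordinate events are countable unions of prefix sets. By [prefix_setI] the generating family is
    a pi-system, so finite measures are determined by it. *)
Lemma prefix_sets_generate : countable [set: G] ->
  @measurable _ (paths G) = <<s [set B | B = set0 \/ exists l, B = prefix_set l] >>.
Proof.
move=> Gc; apply/seteqP; split; last first.
  apply: smallest_sub; first exact: sigma_algebra_measurable.
  by move=> _ [->|[l ->]] //; exact: measurable_prefix_set.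
apply: smallest_sub; first exact: smallest_sigma_algebra.
move=> _ [n [B ->]].
rewrite (@depends_on_prefix_bigcup n.+1 [set w | B (w n)]); last by move=> w w' /= <-.
set C := (X in <<s X >>).
apply: (@countable_bigcupT_measurable _ (g_sigma_algebraType C) _ _ (countable_seq Gc)) => l.
case: ifP => _ //; apply: sub_sigma_algebra; right; by exists l.
Qed.

End Paths.

Section Markov.
Context (R : realType) (G : groupType).
Implicit Types (g x : G) (l : seq G) (w : paths G) (B : set (paths G)).
Variables (nu : prob_measures R G) (eta : probability (paths G) R).

Fixpoint path_prob g l : \bar R :=
  if l is x :: l' then (nu [set (g^-1 * x)%g] * path_prob x l')%E else 1%E.

Lemma path_prob_translate h g l :
  path_prob (h * g)%g [seq (h * x)%g | x <- l] = path_prob g l.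
Proof.
elim: l g => //= x l IH g; rewrite IH; congr (nu [set _] * _)%E.
by rewrite invgM -mulgA mulKg.
Qed.

Lemma path_probE g l : path_prob g l =
  (\prod_(0 <= i < size l) nu [set ((nth 1%g (g :: l) i)^-1 * nth 1%g l i)%g])%E.
Proof.
elim: l g => [|x l IH] g; first by rewrite big_geq.
by rewrite big_nat_recl//= IH.
Qed.

Lemma walk_law_prefix : walk_law nu eta ->
  forall l, eta (prefix_set l) = path_prob 1 l.
Proof.
move=> [d [T [P [X [[ind dist] etaE]]]]] l.
rewrite etaE; last exact: measurable_prefix_set.
(* The leading [1] is the unrecorded starting position, so [a i] is the increment leading to entry
   [i]. *)
pose a i : discr G := ((nth 1%g (1%g :: l) i)^-1 * nth 1%g l i)%g.
pose J := [fset i | i in iota 0 (size l)]%fset.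
have -> : walk X @^-1` prefix_set l = \bigcap_(i in [set` J]) (X i @^-1` [set a i]).
  apply/seteqP; split=> t.
  - move=> h i /=; rewrite !inE mem_iota /= add0n => il.
    have := h i il; rewrite /walk big_ord_recr /= /a.
    case: i il => [|i] il; first by rewrite big_ord0 mul1g invg1 mul1g.
    have := h i (ltnW il); rewrite /walk /= => -> <-.
    by rewrite mulKg.
  - move=> h; have {}h i : (i < size l)%N -> X i t = a i.
      by move=> il; apply: h; rewrite /= !inE mem_iota.
    elim=> [|i IH] il; rewrite /walk big_ord_recr /= h//.
      by rewrite big_ord0 /a /= mul1g invg1 mul1g.
    have := IH (ltnW il); rewrite /walk => ->.
    by rewrite /a /= mulVKg.
rewrite (ind J (fun i => [set a i]))// path_probE.
rewrite (perm_big (iota 0 (size l))); last first.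
  apply: uniq_perm; [exact: fset_uniq|exact: iota_uniq|].
  by move=> i; rewrite !inE.
rewrite /index_iota subn0; apply: eq_bigr => i _.
exact: dist.
Qed.

Hypothesis Gc : countable [set: G].
Hypothesis etaE : forall l, eta (prefix_set l) = path_prob 1 l.

(* The law of the walk started at [g] (which is not recorded in the path). *)
Definition from g B : \bar R := eta (translate g @^-1` B).

Lemma from1 B : from 1 B = eta B.
Proof.
rewrite /from; congr (eta _); apply/seteqP; split=> w /=;
by rewrite (_ : translate 1 w = w)//; apply/funext => n; rewrite /translate mul1g.
Qed.

Lemma from_prefix g l : from g (prefix_set l) = path_prob g l.
Proof.
rewrite /from -(path_prob_translate g^-1%g) mulVg -etaE; congr (eta _).
apply/seteqP; split=> w h i.
- rewrite size_map => il; rewrite (nth_map 1%g)// -h// /translate mulKg//.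
- move=> il; rewrite /translate h ?size_map// (nth_map 1%g)// mulVKg//.
Qed.

Lemma from_translate g h B : from g (translate h @^-1` B) = from (h * g)%g B.
Proof.
rewrite /from; congr (eta _); apply/seteqP; split=> w /=;
by rewrite (_ : translate h (translate g w) = translate (h * g)%g w)//;
   apply/funext => n; rewrite /translate mulgA.
Qed.

(** Both sides are measures in [B], so they need only be compared on prefix sets. *)
Lemma from_markov g x B : measurable B ->
  from g (B `&` [set w | w 0%N = x]) =
  (nu [set (g^-1 * x)%g] * from x (cons_path x @^-1` B))%E.
Proof.
move=> mB.
have mf y := measurable_translate (G := G) y.
have mFx := measurable_first x.
pose m1 : {measure set (paths G) -> \bar R} :=
  mrestr (pushforward eta (translate g)) mFx.
pose c := fine (nu [set (g^-1 * x : discr G)%g]).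
have c0 : 0 <= c by rewrite fine_ge0.
have cE : nu [set (g^-1 * x : discr G)%g] = c%:E by rewrite fineK// fin_num_measure.
pose m2 : {measure set (paths G) -> \bar R} :=
  mscale (NngNum c0) (pushforward (pushforward eta (translate x)) (cons_path x)).
pose n1 := m1 (mf g); pose n2 := m2 (mf x) (measurable_cons_path x).
suff -> : from g (B `&` [set w | w 0%N = x]) = n2 B.
  by rewrite cE /n2 /= /mscale.
rewrite -[LHS]/(n1 B).
pose C : set (set (paths G)) := [set B | B = set0 \/ exists l, B = prefix_set l].
apply: (measure_unique C (fun=> setT)) => //.
- exact: prefix_sets_generate.
- move=> _ _ [->|[l ->]] [->|[l' ->]]; rewrite ?set0I ?setI0; try by left.
  by case: (prefix_setI l l') => ->; [left|right; exists l|right; exists l'].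
- by move=> _; right; exists [::]; rewrite prefix_set_nil.
- by rewrite bigcup_const//; exists 0%N.
- move=> _ [->|[l ->]]; first by rewrite !measure0.
  rewrite /n1 /n2 /m1 /m2 /= /mrestr /mscale /= /pushforward.
  rewrite -!/(from _ _) -cE.
  have fx : from g [set w | w 0%N = x] = nu [set (g^-1 * x : discr G)%g].
    have := from_prefix g [:: x]; rewrite /= mule1 => <-; congr from.
    by rewrite prefix_set_cons prefix_set_nil preimage_setT setIT.
  case: l => [|y l].
    rewrite prefix_set_nil setTI preimage_setT fx.
    by have := from_prefix x [::]; rewrite prefix_set_nil => ->; rewrite mule1.
  rewrite prefix_set_cons; have [->|yx] := eqVneq y x.
    rewrite setIAC setIid -prefix_set_cons from_prefix /= -from_prefix.
    by congr (_ * from _ _)%E; apply/seteqP; split=> [w h [|i]//|w h i];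
      [exact: h|exact: (h i.+1)].
  rewrite (_ : _ `&` _ = set0); last first.
    by apply/seteqP; split=> w //= [[w0 _] w0']; rewrite -w0 w0' eqxx in yx.
  rewrite (_ : cons_path x @^-1` _ = set0); last first.
    by apply/seteqP; split=> w //= [w0 _]; rewrite -w0 eqxx in yx.
  by rewrite /from !preimage_set0 !measure0 mule0.
- move=> _; rewrite /n1 /m1 /= /mrestr /pushforward.
  apply: (le_lt_trans (probability_le1 _ _)); last exact: ltry.
  by apply: measurable_preimage; [exact: mf|exact: measurableI].
Qed.

End Markov.

(** * Harmonicity and approximation of shift-invariant events *)

Section MarkovConsequences.
Context (R : realType) (G : groupType).
Implicit Types (g x : G) (l : seq G) (w : paths G) (A B : set (paths G)).
Variables (nu : prob_measures R G) (eta : probability (paths G) R).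
Hypothesis Gc : countable [set: G].
Hypothesis etaE : forall l, eta (prefix_set l) = path_prob nu 1 l.

Local Notation from := (from eta).

Lemma from_ge0 g B : (0 <= from g B)%E.
Proof. exact: measure_ge0. Qed.

Lemma from_partition g B : measurable B ->
  from g B = (\esum_(x in [set: G])
    (nu [set (g^-1 * x)%g] * from x (cons_path x @^-1` B)))%E.
Proof.
move=> mB; have mg := measurable_translate (G := G) g.
rewrite /from (@measure_countable_partition _ _ _ _ eta
  (fun w : paths G => translate g w 0%N) _ Gc); last 2 first.
- by move=> x; exact: (measurable_preimage mg (measurable_first x)).
- exact: measurable_preimage.
by apply: eq_esum => x _; rewrite -(from_markov Gc etaE).
Qed.

Lemma shift_invariant_cons A x : shift_invariant A -> cons_path x @^-1` A = A.
Proof.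
move=> [_ sA]; apply/seteqP; split=> w /=.
  by rewrite -{1}sA.
by rewrite -{2}sA.
Qed.

Lemma from_harmonic g A : shift_invariant A ->
  from g A = (\esum_(y in [set: G]) (nu [set y] * from (g * y)%g A))%E.
Proof.
move=> sA; rewrite from_partition; last by case: sA.
rewrite (reindex_esum [set: G] [set: G] (fun y => (g * y)%g)).
  by apply: eq_esum => y _; rewrite mulKg shift_invariant_cons.
split=> //; first by move=> x y _ _ /mulgI.
by move=> y _; exists (g^-1 * y)%g => //; rewrite mulVKg.
Qed.

(* All the laws of the walk started at a point charge the first position, so that
   they are equivalent, although the event need not be shift-invariant. *)
Lemma from_null g h B : (forall x : G, nu [set x] != 0%E) -> measurable B ->
  from g B = 0%E -> from h B = 0%E.
Proof.
move=> nu0 mB gB; rewrite from_partition// esum1// => x _.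
suff -> : from x (cons_path x @^-1` B) = 0%E by rewrite mule0.
have mx := measurable_first x.
have : (from g (B `&` [set w | w 0%N = x]) <= 0)%E.
  rewrite -gB; apply: le_measure; rewrite ?inE.
  - by apply: (measurable_preimage (measurable_translate _)); exact: measurableI.
  - exact: (measurable_preimage (measurable_translate _)).
  - by move=> w [].
rewrite (from_markov Gc etaE)// => h0; apply/eqP.
have : (nu [set (g^-1 * x)%g] * from x (cons_path x @^-1` B) == 0)%E.
  by rewrite eq_le h0 mule_ge0// from_ge0.
by rewrite mule_eq0 (negPf (nu0 _)).
Qed.

Section Density.
Variables (A : set (paths G)) (c : R).
Hypotheses (sA : shift_invariant A) (c0 : 0 <= c).
Hypothesis fromA : forall g, (from g A <= c%:E)%E.

Let mA : measurable A. Proof. by case: sA. Qed.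

(** By the Markov property, conditioning a shift-invariant event on a prefix amounts to restarting
    the walk at its last point, where the bound [c] applies. *)
Lemma from_prefix_le g l :
  (from g (A `&` prefix_set l) <= c%:E * from g (prefix_set l))%E.
Proof.
elim: l g => [|x l IH] g.
  rewrite (from_prefix etaE)/= mule1 (le_trans _ (fromA g))//.
  by rewrite prefix_set_nil setIT.
have mAl : measurable (A `&` prefix_set (x :: l)).
  by apply: measurableI => //; exact: measurable_prefix_set.
rewrite (_ : A `&` _ = (A `&` prefix_set (x :: l)) `&` [set w | w 0%N = x]); last first.
  apply/seteqP; split=> [w [Aw wl]|w [] //]; split => //.
  exact: (wl 0%N).
rewrite (from_markov Gc etaE)//.
rewrite (_ : cons_path x @^-1` _ = A `&` prefix_set l); last first.
  rewrite preimage_setI shift_invariant_cons//; congr (_ `&` _).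
  by apply/seteqP; split=> w h i; [exact: (h i.+1)|case: i => // i; exact: h].
rewrite (from_prefix etaE) /= muleCA lee_wpmul2l//.
by rewrite -(from_prefix etaE).
Qed.

Lemma depends_on_prefix_le n B : measurable B -> depends_on_prefix n B ->
  (eta (A `&` B) <= c%:E * eta B)%E.
Proof.
move=> mB dB.
pose f w : seq G := mkseq w n.
have fE l : f @^-1` [set l] = if size l == n then prefix_set l else set0.
  apply/seteqP; split=> w /=.
    move=> <-; rewrite size_mkseq eqxx => i; rewrite size_mkseq => i_n.
    by rewrite nth_mkseq.
  case: eqP => // ln wl; apply: (@eq_from_nth _ 1%g); rewrite ?size_mkseq// => i i_n.
  by rewrite nth_mkseq// wl// ln.
have mf l : measurable (f @^-1` [set l]).
  by rewrite fE; case: ifP => // _; exact: measurable_prefix_set.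
pose m : {measure set (paths G) -> \bar R} := mscale (NngNum c0) eta.
rewrite -[leRHS]/(m B).
rewrite (measure_countable_partition eta (countable_seq Gc) mf); last exact: measurableI.
rewrite (measure_countable_partition m (countable_seq Gc) mf)//.
apply: le_esum => l _; rewrite fE; case: eqP => ln; last by rewrite !setI0 !measure0.
rewrite -setIA; have [->|->] := depends_on_prefixI dB ln.
  by rewrite setI0 !measure0.
by have := from_prefix_le 1 l; rewrite !from1.
Qed.

End Density.

(** These events form a sigma-algebra containing the cylinders, hence they exhaust the measurable
    ones. *)
Definition approximable B : Prop := measurable B /\
  forall e : R, 0 < e -> exists n C, [/\ measurable C, depends_on_prefix n C
    & (eta (B `+` C) <= e%:E)%E].

Lemma depends_on_prefix_widen m n B : (m <= n)%N ->
  depends_on_prefix m B -> depends_on_prefix n B.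
Proof. by move=> mn dB w w' ww'; apply: dB => i im; apply: ww'; exact: leq_trans mn. Qed.

Lemma approximableC B : approximable B -> approximable (~` B).
Proof.
move=> [mB hB]; split=> [|e e0]; first exact: measurableC.
have [n [C [mC dC BC]]] := hB e e0; exists n, (~` C); split.
- exact: measurableC.
- by move=> w w' ww' nCw Cw'; apply: nCw; apply: dC Cw' => i /ww'.
- by rewrite /setY !setDE !setCK setUC [~` B `&` C]setIC [B `&` _]setIC in BC *.
Qed.

Lemma measurableY d (T : measurableType d) (C D : set T) :
  measurable C -> measurable D -> measurable (C `+` D).
Proof. by move=> mC mD; apply: measurableU; exact: measurableD. Qed.

Lemma approximableU B B' : approximable B -> approximable B' ->
  approximable (B `|` B').
Proof.
move=> [mB hB] [mB' hB']; split=> [|e e0]; first exact: measurableU.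
have e2 : 0 < e / 2 by rewrite divr_gt0.
have [n [C [mC dC BC]]] := hB _ e2.
have [n' [C' [mC' dC' BC']]] := hB' _ e2.
exists (maxn n n'), (C `|` C'); split.
- exact: measurableU.
- have {}dC := depends_on_prefix_widen (leq_maxl n n') dC.
  have {}dC' := depends_on_prefix_widen (leq_maxr n n') dC'.
  by move=> w w' ww' [Cw|C'w]; [left; exact: dC Cw|right; exact: dC' C'w].
- apply: (@le_trans _ _ (eta (B `+` C) + eta (B' `+` C'))%E); last first.
    by rewrite (splitr e) EFinD leeD.
  apply: (@le_trans _ _ (eta ((B `+` C) `|` (B' `+` C')))).
    apply: le_measure; rewrite ?inE.
    + by apply: measurableY; exact: measurableU.
    + by apply: measurableU; exact: measurableY.
    + move=> w [[[Bw|Bw] /not_orP[nC nC']]|[[Cw|Cw] /not_orP[nB nB']]].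
      * by left; left.
      * by right; left.
      * by left; right.
      * by right; right.
  by apply: measureU2; exact: measurableY.
Qed.

(** Continuity from below puts a finite union within [e / 2] of the whole union, and that finite
    union is approximated within [e / 2]. *)
Lemma approximable_bigcup (F : nat -> set (paths G)) :
  (forall n, approximable (F n)) -> approximable (\bigcup_n F n).
Proof.
move=> aF.
have mF n : measurable (F n) by case: (aF n).
have mUF : measurable (\bigcup_n F n) by exact: bigcup_measurable.
split=> // e e0.
pose H n := \big[setU/set0]_(i < n.+1) F i.
have aH n : approximable (H n).
  rewrite /H; elim: n => [|n IH]; first by rewrite big_ord1.
  by rewrite big_ord_recr; exact: approximableU.
have mH n : measurable (H n) by case: (aH n).
have HF n : H n `<=` \bigcup_n F n by exact: bigsetU_bigcup.
have UH : \bigcup_n H n = \bigcup_n F n by exact: bigcup_bigsetU_bigcup.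
have e2 : 0 < e / 2 by rewrite divr_gt0.
have cH : eta \o H @ \oo --> eta (\bigcup_n F n).
  rewrite -UH; apply: nondecreasing_cvg_mu => //.
    by rewrite UH.
  by move=> m n mn; apply/subsetPset; exact: subset_bigsetU.
have Ufin : eta (\bigcup_n F n) \is a fin_num by exact: fin_num_measure.
have [n hn] : exists n, (eta (\bigcup_n F n) - (e / 2)%:E < eta (H n))%E.
  apply: contrapT => /forallNP h.
  have : (eta (\bigcup_n F n) <= eta (\bigcup_n F n) - (e / 2)%:E)%E.
    rewrite -{1}(cvg_lim _ cH)//; apply: lime_le; first by apply/cvg_ex; eexists; exact: cH.
    by apply: nearW => n; rewrite leNgt; apply/negP; exact: h.
  by apply/negP; rewrite -ltNge lteBlDr// lteDl.
have [k [C [mC dC HC]]] := (aH n).2 _ e2.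
exists k, C; split => //.
apply: (@le_trans _ _ (eta ((\bigcup_n F n) `\` H n) + eta (H n `+` C))%E).
  apply: (@le_trans _ _ (eta (((\bigcup_n F n) `\` H n) `|` (H n `+` C)))).
    apply: le_measure; rewrite ?inE.
    + exact: measurableY.
    + by apply: measurableU; [exact: measurableD|exact: measurableY].
    + move=> w [[Uw nC]|[Cw nU]].
        by have [Hw|nH] := pselect (H n w); [right; left|left].
      by right; right; split => // Hw; apply: nU; exact: (HF n).
  by apply: measureU2; [exact: measurableD|exact: measurableY].
rewrite (splitr e) EFinD leeD// measureD// ?(le_lt_trans (probability_le1 _ _)) ?ltry//.
rewrite setIidr; last exact: HF.
rewrite leeBlDr ?fin_num_measure// addeC -leeBlDr//.
exact: ltW.
Qed.

Lemma approximable_measurable B : measurable B -> approximable B.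
Proof.
apply: smallest_sub => [|_ [n [B' ->]]].
  split.
  - split=> // e e0; exists 0%N, set0; split => //.
    by rewrite setYK measure0 lee_fin ltW.
  - by move=> C; rewrite setTD; exact: approximableC.
  - exact: approximable_bigcup.
have mB : measurable [set w : paths G | B' (w n)].
  by apply: sub_sigma_algebra; exists n, B'.
split=> // e e0; exists n.+1, [set w | B' (w n)]; split => //.
  by move=> w w' ww' /=; rewrite ww'.
by rewrite setYK measure0 lee_fin ltW.
Qed.

(** This takes the place of martingale convergence. Were all values at most [1 - e], every event [C]
    of finitely many steps would meet [A] in measure at most [(1 - e) * eta C]; letting [C] approach
    [A] gives [eta A <= (1 - e) * eta A]. *)
Lemma shift_invariant_from_lt A (e : R) : shift_invariant A -> eta A != 0%E ->
  0 < e <= 1 -> exists g, ((1 - e)%:E < from g A)%E.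
Proof.
move=> sA A0 /andP[e0 e1]; have mA : measurable A by case: sA.
apply: contrapT => /forallNP h.
have hA g : (from g A <= (1 - e)%:E)%E by rewrite leNgt; apply/negP.
have e1' : 0 <= 1 - e by rewrite subr_ge0.
move/eqP: A0; apply.
pose a := fine (eta A).
have aE : eta A = a%:E by rewrite fineK// fin_num_measure.
have a0 : 0 <= a by rewrite fine_ge0.
suff : a <= 0 by move=> ale; rewrite aE; congr EFin; apply/eqP; rewrite eq_le ale.
apply/ler_addgt0Pl => d d0; rewrite addr0.
(* The approximation error enters twice and is finally divided by [e], which leaves at most [d]. *)
have d2 : 0 < e * d / 2 by rewrite divr_gt0// mulr_gt0.
have [n [C [mC dC AC]]] := (approximable_measurable mA).2 _ d2.
have h1 := depends_on_prefix_le sA e1' hA mC dC.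
pose c := fine (eta C).
have cE : eta C = c%:E by rewrite fineK// fin_num_measure.
have h2 : (eta A <= eta (A `&` C) + eta (A `+` C))%E.
  apply: (@le_trans _ _ (eta ((A `&` C) `|` (A `+` C)))).
    apply: le_measure; rewrite ?inE//.
      by apply: measurableU; [exact: measurableI|exact: measurableY].
    by move=> w Aw; have [Cw|nC] := pselect (C w); [left|right; left].
  by apply: measureU2; [exact: measurableI|exact: measurableY].
have h3 : (eta C <= eta A + eta (A `+` C))%E.
  apply: (@le_trans _ _ (eta (A `|` (A `+` C)))).
    apply: le_measure; rewrite ?inE//.
      by apply: measurableU => //; exact: measurableY.
    by move=> w Cw; have [Aw|nA] := pselect (A w); [left|right; right].
  by apply: measureU2 => //; exact: measurableY.
have {}h3 : c <= a + e * d / 2.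
  by rewrite -lee_fin -cE (le_trans h3)// aE EFinD leeD2l.
have {}h2 : a <= (1 - e) * c + e * d / 2.
  by rewrite -lee_fin -aE (le_trans h2)// EFinD leeD// EFinM -cE.
have h4 : (1 - e) * c <= (1 - e) * (a + e * d / 2) by rewrite ler_wpM2l.
have h5 : e * a <= e * d by have := mulr_ge0 (ltW e0) (ltW d2); lra.
by rewrite ler_pM2l in h5.
Qed.

End MarkovConsequences.

(** * Stabilizers of boundary points *)

Lemma standard_borel_separating (R : realType) d (B : measurableType d) :
  standard_borel R B ->
  exists C : nat -> set B, (forall n, measurable (C n)) /\
    forall x y, x <> y -> exists2 n, C n x & ~ C n y.
Proof.
move=> [M [f [hM sM fbij mE]]].
have finj : injective f by case: fbij => g fK _; exact: can_inj fK.
have [V /countable_injP[e einj] [oV bV]] := sM.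
(* The basic open set numbered [n], or the empty set if there is none. *)
pose O n := \bigcup_(U in [set U | V U /\ e U = n]) U.
exists (fun n => f @^-1` O n); split.
  move=> n; rewrite mE; exists (O n); last by rewrite setTI.
  by apply: sub_sigma_algebra; apply: bigcup_open => U [/oV].
move=> x y xy; move: hM; rewrite open_hausdorff => hM.
have [|[U1 U2] [/= /set_mem xU1 /set_mem yU2] [oU1 oU2 /eqP U12]] := hM (f x) (f y).
  by apply/eqP => /finj.
have [U [VU Ux] UU1] := bV (f x) U1 (open_nbhs_nbhs (conj oU1 xU1)).
exists (e U); first by exists U => //; split => //.
move=> [U' [VU' eU] U'y].
have eUU : U' = U by apply: einj; rewrite ?inE.
suff : (U1 `&` U2) (f y) by rewrite U12.
by split => //; apply: UU1; rewrite -eUU.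
Qed.

Section Boundary.
Context (R : realType) (G : groupType).
Implicit Types (g x : G) (w : paths G) (A : set (paths G)) (S : seq G).

(* The margin for which the bound of [almost_harmonic_separation] is
   contradictory as soon as [mass sig ^+ n < 1/2]. *)
Definition visibility_gap S : R := (8 * (size S).+1%:R)^-1.

(** A condition on [nu] alone, free of any boundary. Fixing [x] splits it into countably many
    conditions for the Baire category argument. *)
Definition no_separation S (nu : prob_measures R G) x : Prop :=
  forall u : G -> R, (forall y, 0 <= u y <= 1) ->
    (forall y, (u y)%:E = \esum_(z in [set: G]) (nu [set z] * (u (y * z)%g)%:E))%E ->
    1 - visibility_gap S < u x ->
    exists2 s, s \in S & visibility_gap S < u (s * x)%g.

Lemma visibility_gap_gt0 S : 0 < visibility_gap S.
Proof. by rewrite invr_gt0 mulr_gt0. Qed.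

Lemma visibility_gap_le1 S : visibility_gap S <= 1.
Proof.
rewrite invf_le1; first by rewrite -natrM ler1n.
by rewrite mulr_gt0.
Qed.

Section Fixed.
Variables (nu : prob_measures R G) (eta : probability (paths G) R) (S : seq G).
Hypothesis Gc : countable [set: G].
Hypothesis etaE : forall l, eta (prefix_set l) = path_prob nu 1 l.
Hypothesis nu0 : forall g : discr G, nu [set g] != 0%E.
Hypothesis nosep : forall x, no_separation S nu x.

(** The probability [u] of [A] as a function of the starting point is harmonic, and almost
    disjointness gives [u x + u (s * x) <= 1]; a value near 1 then contradicts [no_separation]. *)
Lemma shift_invariant_displaced_null A : shift_invariant A ->
  (forall s, s \in S -> eta (A `&` translate s @^-1` A) = 0%E) -> eta A = 0%E.
Proof.
move=> sA As; have mA : measurable A by case: sA.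
have mt (g : G) (B : set (paths G)) : measurable B -> measurable (translate g @^-1` B).
  by move=> mB; exact: (measurable_preimage (measurable_translate g)).
apply/eqP; apply: contrapT => /negP eA.
have [|x hx] := shift_invariant_from_lt Gc etaE sA eA (e := visibility_gap S).
  by rewrite visibility_gap_gt0 visibility_gap_le1.
pose u g := fine (from eta g A).
have uE g : from eta g A = (u g)%:E by rewrite fineK// fin_num_measure//; exact: mt.
have u01 g : 0 <= u g <= 1.
  rewrite -!lee_fin -uE from_ge0/=; apply: probability_le1; exact: mt.
have uh y : ((u y)%:E = \esum_(z in [set: G]) (nu [set z] * (u (y * z)%g)%:E))%E.
  rewrite -uE (from_harmonic Gc etaE y sA); apply: eq_esum => z _.
  by rewrite uE.
have [|s sS] := nosep u01 uh (x := x); first by rewrite -lte_fin -uE.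
apply/negP; rewrite -leNgt.
have h : (from eta x A + from eta x (translate s @^-1` A) <= 1)%E.
  have null : from eta x (A `&` translate s @^-1` A) = 0%E.
    apply: (@from_null _ _ nu _ Gc etaE 1) => //.
      by apply: measurableI => //; exact: mt.
    by rewrite from1; exact: As.
  have mA' := mt s _ mA.
  rewrite -[leLHS]sube0 -null /from -measureUfinr.
  - by apply: probability_le1; apply: measurableU; exact: mt.
  - exact: mt.
  - exact: mt.
  - by rewrite (le_lt_trans (probability_le1 _ _)) ?ltry//; exact: mt.
move: h; rewrite from_translate !uE -EFinD lee_fin.
by move: hx; rewrite uE lte_fin; lra.
Qed.

Variables (d : measure_display) (B : measurableType d).
Variables (bnd : {mfun paths G >-> B}) (act : G -> B -> B).
Hypothesis pb : poisson_boundary eta bnd.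
Hypothesis ia : induced_action eta bnd act.

(** An invariant event [A] representing [D] is almost disjoint from its translates: exceptions lie
    in [N], in a translate of [N], null by [from_null], or where [bnd] is not equivariant. *)
Lemma displaced_set_null (D : set B) : measurable D ->
  (forall s, s \in S -> forall b, D b -> ~ D (act s b)) ->
  eta (bnd @^-1` D) = 0%E.
Proof.
move=> mD DS; have [_ + _] := pb => /(_ D mD)[A sA N0].
have mA : measurable A by case: sA.
have mbD : measurable (bnd @^-1` D) by exact: (measurable_preimage (f := bnd)).
pose N := bnd @^-1` D `+` A.
have mN : measurable N by exact: measurableY.
have mt (g : G) (C : set (paths G)) : measurable C -> measurable (translate g @^-1` C).
  by move=> mC; exact: (measurable_preimage (measurable_translate g)).
have A0 : eta A = 0%E.
  apply: shift_invariant_displaced_null => // s sS.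
  have [_ _ _ /(_ s)[K [mK K0 hK]]] := ia.
  have tN0 : eta (translate s @^-1` N) = 0%E.
    by apply: (@from_null _ _ nu _ Gc etaE 1 s) => //; rewrite from1.
  have mAA : measurable (A `&` translate s @^-1` A) by apply: measurableI => //; exact: mt.
  apply: measure_negligible => //.
  apply: (@negligibleS _ _ _ _ (N `|` translate s @^-1` N `|` K)); last first.
    apply: negligibleU; first apply: negligibleU.
    - by exists N; split.
    - by exists (translate s @^-1` N); split => //; exact: mt.
    - by exists K; split.
  move=> w [Aw Asw]; apply: contrapT => /not_orP[/not_orP[nN ntN] nK].
  have Dw : D (bnd w) by apply: contrapT => nD; apply: nN; right.
  have Dsw : D (bnd (translate s w)) by apply: contrapT => nD; apply: ntN; right.
  have : bnd (translate s w) = act s (bnd w) by apply: contrapT => h; apply: nK; exact: hK.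
  by move=> h; move: Dsw; rewrite h; exact: DS.
apply: measure_negligible => //.
apply: (@negligibleS _ _ _ _ (A `|` N)); last first.
  by apply: negligibleU; [exists A; split|exists N; split].
by move=> w Dw; have [Aw|nA] := pselect (A w); [left|right; left].
Qed.

End Fixed.

(** If [s] moves [b], some [C m] contains [b] but not [act s b], and the points with this property
    form a set disjoint from its image under [s]. Induction on [S] intersects such sets. *)
Lemma displaced_cover d (B : measurableType d) (act : G -> B -> B) S
    (C : nat -> set B) :
  (forall g, measurable_fun [set: B] (act g)) ->
  (forall n, measurable (C n)) ->
  (forall b c, b <> c -> exists2 n, C n b & ~ C n c) ->
  exists D : nat -> set B, [/\ forall n, measurable (D n),
    forall n s, s \in S -> forall b, D n b -> ~ D n (act s b)
    & forall b, (forall s, s \in S -> act s b <> b) -> exists n, D n b].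
Proof.
move=> mact mC Csep; elim: S => [|s S [D [mD DS Dcov]]].
  by exists (fun=> setT); split => // x _; exists 0%N.
pose E n m := D n `&` (C m `&` act s @^-1` (~` C m)).
have mE n m : measurable (E n m).
  apply: measurableI => //; apply: measurableI => //.
  by apply: (measurable_preimage (mact s)); exact: measurableC.
exists (fun k => if choice.unpickle k is Some (n, m) then E n m else set0); split.
- by move=> k; case: choice.unpickle => [[n m]|].
- move=> k t; case: choice.unpickle => [[n m]|] // + x.
  rewrite inE => /predU1P[->|tS].
    by move=> [_ [_ nC]] [_ [sC _]].
  by move=> [Dx _] [Dtx _]; exact: (DS n t tS x).
- move=> x hx; have [t tS|n Dn] := Dcov x.
    by apply: hx; rewrite inE tS orbT.
  have [|m Cm nCm] := Csep x (act s x).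
    by apply/nesym; apply: hx; rewrite inE eqxx.
  by exists (choice.pickle (n, m)); rewrite choice.pickleK.
Qed.

(** Full support gives non-degeneracy. The points fixed by no element of [S] are covered by
    countably many displaced sets, each of them null. *)
Lemma no_separation_stabilizers (nu : prob_measures R G) S :
  countable [set: G] -> (forall g : discr G, nu [set g] != 0%E) ->
  (forall x, no_separation S nu x) -> boundary_stabilizers_meet [set` S] nu.
Proof.
move=> Gc nu0 nosep; split.
  apply/seteqP; split=> // g _ H [_ HS]; apply: HS.
  exact: nu0.
move=> eta d B bnd act wl pb ia.
have etaE := walk_law_prefix wl.
have [C [mC Csep]] : exists C : nat -> set B, (forall n, measurable (C n)) /\
    forall b c, b <> c -> exists2 n, C n b & ~ C n c.
  by case: pb => /standard_borel_separating.
have [_ _ mact _] := ia.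
have [D [mD DS Dcov]] := displaced_cover S mact mC Csep.
exists (\bigcup_n D n); split.
- exact: bigcup_measurable.
- apply: measure_negligible; first exact: bigcup_measurable.
  apply: negligible_bigcup => n; exists (D n); split => //.
  exact: (displaced_set_null Gc etaE nu0 nosep pb ia (mD n) (DS n)).
- move=> x /= nx; have [s sS sx|n Dn] := Dcov x; last by exists n.
  by apply: nx; exists s.
Qed.

End Boundary.

Lemma residual_subset (T : topologicalType) (A B : set T) :
  A `<=` B -> residual A -> residual B.
Proof. by move=> AB [U [hU UA]]; exists U; split => //; exact: subset_trans AB. Qed.

(** * Genericity of full support and of non-separation *)

Section Generic.
Context (R : realType) (G : groupType).
Implicit Types (nu : prob_measures R G) (g x : G) (S : seq G) (u : G -> R).
Hypothesis Gc : countable [set: G].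

Lemma l1dist_ge nu nu' g :
  (`|nu [set (g : discr G)] - nu' [set (g : discr G)]| <= l1dist nu nu')%E.
Proof.
apply: esum_ge; exists [set (g : discr G)]; first by split.
by rewrite fsbig_set1.
Qed.

Lemma esum_l1dist nu nu' u : (forall x, 0 <= u x <= 1) ->
  (\esum_(g in [set: G]) (nu [set g] * (u g)%:E) <=
   \esum_(g in [set: G]) (nu' [set g] * (u g)%:E) + l1dist nu nu')%E.
Proof.
move=> u01.
have -> : l1dist nu nu' = (\esum_(g in [set: G]) `|nu [set g] - nu' [set g]|)%E by [].
rewrite -esumD; last 2 first.
- by move=> g _; rewrite mule_ge0// lee_fin; case/andP: (u01 g).
- by move=> g _; exact: abse_ge0.
apply: le_esum => g _.
have fE (m : prob_measures R G) : m [set (g : discr G)] = (fine (m [set (g : discr G)]))%:E.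
  by rewrite fineK// fin_num_measure.
rewrite (fE nu) (fE nu') -EFinB abse_EFin -!EFinM -EFinD lee_fin.
have /andP[u0 u1] := u01 g.
have := ler_norm (fine (nu [set g]) - fine (nu' [set g])).
have := normr_ge0 (fine (nu [set g]) - fine (nu' [set g])).
set a := fine _; set b := fine _; set c := `|_| => c0 abc.
have : (a - b) * u g <= c * u g by rewrite ler_wpM2r.
have : c * u g <= c by rewrite ler_piMr.
by lra.
Qed.

(** Splitting [lam] equally between [g] and [g^-1] keeps symmetry, and measures closer to [nu] than
    its mass at [g] still charge [g]. *)
Lemma charged_robust g nu0 (e : R) : 0 < e -> exists nu,
  [/\ (l1dist nu0 nu < e%:E)%E, symmetric_measures nu0 -> symmetric_measures nu
    & nbhs nu [set nu : prob_measures R G | nu [set (g : discr G)] != 0%E]].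
Proof.
move=> e0; have [sig [sig0 sig1 h]] := perturbation nu0 Gc e0.
pose lam : seq (R * G) := [:: (2^-1, g); (2^-1, g^-1%g)].
have lam0 : nonneg_weights lam by move=> p; rewrite !inE => /orP[]/eqP->; rewrite invr_ge0.
have [||nu [d s nuE]] := h lam lam0.
- by rewrite /mass !big_cons big_nil /=; lra.
- move=> x; rewrite /weight !big_cons !big_nil /= addrCA.
  by rewrite (inj_eq invg_inj) -{1}[x]invgK (inj_eq invg_inj).
exists nu; split => //; apply/l1dist_nbhsP.
have w0 := weight_ge0 g sig0.
have wl : 2^-1 <= weight lam g.
  by rewrite /weight !big_cons big_nil /= eqxx mulr1 addr0 lerDl mulr_ge0// invr_ge0.
pose r := weight sig g + (1 - mass sig) * weight lam g.
have r0 : 0 < r by rewrite ltr_wpDl// mulr_gt0 ?subr_gt0//; lra.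
exists r => // nu' d'; apply/eqP => nu'0.
have := le_lt_trans (l1dist_ge nu nu' g) d'.
by rewrite nu'0 sube0 nuE abse_EFin ger0_norm ?(ltW r0)// ltxx.
Qed.

(** The choices are made in the order [sig], [N], [lam] adapted to [reach sig N x], radius [k]. A
    function harmonic for a measure within [k] of [nu] is almost harmonic for [nu] with error [k],
    so the separation estimate applies. *)
Lemma no_separation_robust S x nu0 (e : R) :
  amenably_visible R [set` S] -> 0 < e -> exists nu,
  [/\ (l1dist nu0 nu < e%:E)%E, symmetric_measures nu0 -> symmetric_measures nu
    & nbhs nu [set nu | no_separation S nu x]].
Proof.
move=> visS e0; have [sig [sig0 sig1 h]] := perturbation nu0 Gc e0.
have sigm : 0 <= mass sig by rewrite /mass big_seq sumr_ge0.
have [N hN] : exists N, mass sig ^+ N < 2^-1.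
  have /cvgr0Pnorm_lt /(_ 2^-1) : (fun n => mass sig ^+ n) @ \oo --> (0 : R).
    by apply: cvg_expr; rewrite ger0_norm.
  rewrite invr_gt0 => /(_ (ltr0n _ 2))[N _ hN]; exists N.
  by have := hN N (leqnn N); rewrite /= ger0_norm// exprn_ge0.
have [lam [lam0 lam1 lams hlam]] := visible_weights (reach sig N x) Gc visS.
have [nu [d s nuE]] := h lam lam0 lam1 lams.
exists nu; split => //; apply/l1dist_nbhsP.
have gap0 := visibility_gap_gt0 R S.
(* The errors of [N] rounds together stay within the gap; [N.+1] keeps the denominator nonzero. *)
pose k : R := visibility_gap R S / N.+1%:R.
have k0 : 0 < k by rewrite divr_gt0.
exists k => // nu' dk u u01 uh ux; apply: contrapT => hs.
have us s' : s' \in S -> u (s' * x)%g <= visibility_gap R S.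
  by move=> s'S; rewrite leNgt; apply/negP => h'; apply: hs; exists s'.
have dk' : (l1dist nu' nu < k%:E)%E by exact: (@ball_sym R (prob_measures R G) nu nu').
have nuu y : (\esum_(z in [set: G]) (nu [set z] * (u (y * z)%g)%:E) =
    (average sig u y + (1 - mass sig) * average lam u y)%:E)%E.
  have u0 z : 0 <= u z by case/andP: (u01 z).
  rewrite EFinD -(esum_weight sig0 (f := fun z => u (y * z)%g))//.
  rewrite (_ : (1 - mass sig) * average lam u y =
      \sum_(p <- lam) p.1 * ((1 - mass sig) * u (y * p.2)%g)); last first.
    by rewrite mulr_sumr; apply: eq_bigr => p _; rewrite mulrCA.
  have sig1' : 0 <= 1 - mass sig by rewrite subr_ge0 ltW.
  rewrite -(esum_weight lam0 (f := fun z => (1 - mass sig) * u (y * z)%g)); last first.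
    by move=> z; rewrite mulr_ge0.
  rewrite -esumD; last 2 first.
  - by move=> z _; rewrite lee_fin mulr_ge0// weight_ge0.
  - by move=> z _; rewrite lee_fin mulr_ge0 ?weight_ge0// mulr_ge0.
  apply: eq_esum => z _; rewrite nuE -EFinM -EFinD; congr EFin; ring.
have uharm y : `|u y - (average sig u y + (1 - mass sig) * average lam u y)| <= k.
  have uy01 z : 0 <= u (y * z)%g <= 1 by [].
  have h1 := esum_l1dist nu' nu uy01; have h2 := esum_l1dist nu nu' uy01.
  rewrite -uh nuu in h1 h2.
  have {}h1 := le_trans h1 (leeD2l _ (ltW dk')).
  have {}h2 := le_trans h2 (leeD2l _ (ltW dk)).
  by move: h1 h2; rewrite -!EFinD !lee_fin ler_norml; lra.
have := almost_harmonic_separation sig0 (ltW sig1) (fun y => proj1 (andP (u01 y)))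
  (fun y => proj2 (andP (u01 y))) (ltW k0) uharm (hlam u u01).
have hsum : \sum_(s <- S) u (s * x)%g <= (size S)%:R * visibility_gap R S.
  rewrite mulr_natl -[X in _ *+ X]count_predT -iter_addr_0 -big_const_seq.
  by rewrite big_seq [leRHS]big_seq; apply: ler_sum.
have hk : N%:R * k <= visibility_gap R S.
  by rewrite /k mulrCA ler_piMr ?(ltW gap0)// ler_pdivrMr ?mul1r// ler_nat.
have hk' : (size S).+1%:R * (N%:R * k) <= (size S).+1%:R * visibility_gap R S.
  by rewrite ler_wpM2l.
have hg : (size S).+1%:R * visibility_gap R S = 8^-1.
  by rewrite /visibility_gap invfM mulrCA mulfV ?mulr1// pnatr_eq0.
have hg' : (size S)%:R * visibility_gap R S + visibility_gap R S = 8^-1.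
  by rewrite -hg -[(size S).+1]addn1 natrD mulrDl mul1r.
(* The left side of the estimate exceeds 1/4. On the right, [1 - u x] and the sum over [S] give less
   than 1/8 together, and the error term at most 1/8. *)
lra.
Qed.

Lemma stabilizers_meet_generic S : amenably_visible R [set` S] ->
  residual [set nu : prob_measures R G | boundary_stabilizers_meet [set` S] nu] /\
  residual [set nu : set_type (symmetric_measures (R := R) (G := G)) |
              boundary_stabilizers_meet [set` S] (set_val nu)].
Proof.
move=> visS; have /countable_injP[f finj] := Gc.
pose dec n : G := xget 1%g [set g | f g = n].
have fK g : dec (f g) = g.
  by apply: finj; rewrite ?inE//; apply: (@xgetPex _ 1%g [set h | f h = f g]); exists g.
(* Odd indices run through the conditions of full support, even ones through non-separation at each
   point. *)
pose W n : set (prob_measures R G) := if odd n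
  then [set nu : prob_measures R G | nu [set (dec n./2 : discr G)] != 0%E]
  else [set nu : prob_measures R G | no_separation S nu (dec n./2)].
have WP nu : (\bigcap_n W n) nu -> boundary_stabilizers_meet [set` S] nu.
  move=> Wnu; apply: no_separation_stabilizers => // [g|x].
    have := Wnu (f g).*2.+1 I; rewrite /W /= odd_double /= uphalf_double.
    by rewrite fK.
  by have := Wnu (f x).*2 I; rewrite /W odd_double doubleK fK.
have [] := @residual_robust R G W.
  move=> n nu0 e e0; rewrite /W; case: odd.
    exact: charged_robust.
  exact: no_separation_robust.
move=> h1 h2; split; [apply: residual_subset h1|apply: residual_subset h2];
  by move=> nu; exact: WP.
Qed.

End Generic.

Theorem corollary3 (R : realType) (G : groupType) (S : set G)
    (countG : countable [set: G]) (finS : finite_set S) (S0 : S !=set0)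
    (visS : amenably_visible R S) :
  residual [set nu : prob_measures R G | boundary_stabilizers_meet S nu] /\
  residual [set nu : set_type (symmetric_measures (R := R) (G := G)) |
              boundary_stabilizers_meet S (set_val nu)].
Proof.
move: finS => /finite_seqP[s S_s]; rewrite S_s in visS *.
exact: stabilizers_meet_generic.
Qed.
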